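(* For $f\in\mathcal{A}_c(\mathbb{R})$ let $\Omega_f(s)=\int_{-\infty}^\infty v_s f$ ($s\in\mathbb{R}$). (a) Let $\mathcal{C}_c(\mathbb{R})=\{\Omega_f\mid f\in\mathcal{A}_c(\mathbb{R})\}$ with norm $\|\Omega_f\|^{(1)}=\|f\|$. Then $\mathcal{C}_c(\mathbb{R})$ is a Banach space isometrically isomorphic to $\mathcal{A}_c(\mathbb{R})$. (b) Let $\mathcal{D}_c(\mathbb{R})=\{\Omega_f''\mid f\in\mathcal{A}_c(\mathbb{R})\}$ (second distributional derivatives) with norm $\|\Omega_f''\|^{(2)}=\|f\|$. Then $\mathcal{D}_c(\mathbb{R})$ is a Banach space isometrically isomorphic to $\mathcal{A}_c(\mathbb{R})$. (c) The four Banach spaces $\mathcal{A}_c(\mathbb{R})$ (with the Alexiewicz norm), $\mathcal{B}_c(\mathbb{R})$ (with the uniform norm), $\mathcal{C}_c(\mathbb{R})$ and $\mathcal{D}_c(\mathbb{R})$ are isometrically isomorphic.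
   Context: A function $F:[-\infty,\infty]\to\mathbb{C}$ is continuous on the extended real line if it is continuous on $\mathbb{R}$ and the limits $F(\pm\infty)$ exist. $\mathcal{B}_c(\mathbb{R})$ is the set of such $F$ with $F(-\infty)=0$, normed by $\|F\|_\infty=\sup|F|$. $\mathcal{A}_c(\mathbb{R})$ is the set of tempered distributions $f=F'$ (distributional derivative) with $F\in\mathcal{B}_c(\mathbb{R})$ (the primitive, unique); the Alexiewicz norm is $\|f\|=\|F\|_\infty$. For $g$ of bounded variation on $\mathbb{R}$, $\int_{-\infty}^\infty fg=F(\infty)g(\infty)-\int_{-\infty}^\infty F\,dg$. For $s,t\in\mathbb{R}$, $v_s(t)=(1-ist-e^{-ist})/t^2$ ($t\ne0$), $v_s(0)=s^2/2$; $v_s$ is of bounded variation in $t$. *)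

(* Defs.v *)
From Stdlib Require Import Reals ClassicalEpsilon.
From Coquelicot Require Import Coquelicot.
Open Scope R_scope.

Definition zerof {A : Type} : A -> C := fun _ => RtoC 0.
Definition addf {A : Type} (u v : A -> C) : A -> C := fun a => Cplus (u a) (v a).
Definition scalf {A : Type} (c : C) (u : A -> C) : A -> C := fun a => Cmult c (u a).
Definition subf {A : Type} (u v : A -> C) : A -> C := fun a => Cminus (u a) (v a).

Definition subspace {A : Type} (X : (A -> C) -> Prop) : Prop :=
  X zerof /\ (forall u v, X u -> X v -> X (addf u v)) /\
  (forall c u, X u -> X (scalf c u)).

Definition norm_on {A : Type} (X : (A -> C) -> Prop) (n : (A -> C) -> R) : Prop :=
  (forall u, X u -> 0 <= n u) /\
  (forall u, X u -> n u = 0 -> u = zerof) /\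
  (forall c u, X u -> n (scalf c u) = Cmod c * n u) /\
  (forall u v, X u -> X v -> n (addf u v) <= n u + n v).

Definition complete_on {A : Type} (X : (A -> C) -> Prop) (n : (A -> C) -> R) : Prop :=
  forall u : nat -> (A -> C), (forall k, X (u k)) ->
  (forall eps, 0 < eps -> exists N, forall p q, (N <= p)%nat -> (N <= q)%nat ->
      n (subf (u p) (u q)) < eps) ->
  exists l, X l /\ forall eps, 0 < eps -> exists N, forall k, (N <= k)%nat ->
      n (subf (u k) l) < eps.

Definition banach {A : Type} (X : (A -> C) -> Prop) (n : (A -> C) -> R) : Prop :=
  subspace X /\ norm_on X n /\ complete_on X n.

Definition isometric_iso_via {A B : Type} (T : (A -> C) -> (B -> C))
  (X : (A -> C) -> Prop) (nX : (A -> C) -> R)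
  (Y : (B -> C) -> Prop) (nY : (B -> C) -> R) : Prop :=
  (forall u, X u -> Y (T u)) /\
  (forall y, Y y -> exists u, X u /\ T u = y) /\
  (forall u v, X u -> X v -> T u = T v -> u = v) /\
  (forall u v, X u -> X v -> T (addf u v) = addf (T u) (T v)) /\
  (forall c u, X u -> T (scalf c u) = scalf c (T u)) /\
  (forall u, X u -> nY (T u) = nX u).

Definition isometric_iso {A B : Type}
  (X : (A -> C) -> Prop) (nX : (A -> C) -> R)
  (Y : (B -> C) -> Prop) (nY : (B -> C) -> R) : Prop :=
  exists T, isometric_iso_via T X nX Y nY.

Definition Bc (F : R -> C) : Prop :=
  (forall x, continuous F x) /\
  filterlim F (Rbar_locally m_infty) (locally (RtoC 0)) /\
  (exists l : C, filterlim F (Rbar_locally p_infty) (locally l)).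

Definition supnorm (F : R -> C) : R :=
  real (Lub_Rbar (fun r => exists x, r = Cmod (F x))).

Definition lim_pinfty (F : R -> C) : C :=
  (real (Lim (fun x => fst (F x)) p_infty), real (Lim (fun x => snd (F x)) p_infty)).

(* Real-valued Schwartz test functions. A (complex) tempered distribution is
   encoded as its action on real Schwartz functions, set to 0 off the Schwartz
   class so that equality of distributions is equality of Coq functions. *)
Definition schwartz (phi : R -> R) : Prop :=
  (forall n x, ex_derive (Derive_n phi n) x) /\
  (forall k n : nat, exists M, forall x, Rabs (x ^ k * Derive_n phi n x) <= M).

Definition distr := (R -> R) -> C.

Definition on_schwartz (g : (R -> R) -> C) : distr :=
  fun phi => if excluded_middle_informative (schwartz phi) then g phi else RtoC 0.

Definition Rint (h : R -> C) : C :=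
  @RInt_gen C_R_CompleteNormedModule h (Rbar_locally m_infty) (Rbar_locally p_infty).

Definition dderiv (F : R -> C) : distr :=
  on_schwartz (fun phi => Copp (Rint (fun x => Cmult (RtoC (Derive phi x)) (F x)))).

Definition dderiv2 (W : R -> C) : distr :=
  on_schwartz (fun phi => Rint (fun x => Cmult (RtoC (Derive_n phi 2 x)) (W x))).

Definition Ac (f : distr) : Prop := exists F, Bc F /\ f = dderiv F.

(* the primitive of f (unique for f in A_c) *)
Definition prim (f : distr) : R -> C :=
  epsilon (inhabits zerof) (fun F => Bc F /\ f = dderiv F).

Definition alex (f : distr) : R := supnorm (prim f).

(* v_s(t) = (1 - i s t - e^{-i s t}) / t^2, v_s(0) = s^2/2, written in
   real and imaginary parts. *)
Definition v (s t : R) : C :=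
  if Req_EM_T t 0 then (s ^ 2 / 2, 0)
  else ((1 - cos (s * t)) / t ^ 2, (sin (s * t) - s * t) / t ^ 2).

Definition DeriveC (g : R -> C) (t : R) : C :=
  (Derive (fun u => fst (g u)) t, Derive (fun u => snd (g u)) t).

(* Stieltjes integral  int F dg  for differentiable g of bounded variation *)
Definition stieltjes (F g : R -> C) : C := Rint (fun t => Cmult (F t) (DeriveC g t)).

Definition pairing (f : distr) (g : R -> C) : C :=
  Cminus (Cmult (lim_pinfty (prim f)) (lim_pinfty g)) (stieltjes (prim f) g).

Definition Omega (f : distr) : R -> C := fun s => pairing f (v s).

Definition Cc (w : R -> C) : Prop := exists f, Ac f /\ w = Omega f.
Definition norm1 (w : R -> C) : R :=
  alex (epsilon (inhabits zerof) (fun f => Ac f /\ w = Omega f)).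

Definition Dc (d : distr) : Prop := exists f, Ac f /\ d = dderiv2 (Omega f).
Definition norm2 (d : distr) : R :=
  alex (epsilon (inhabits zerof) (fun f => Ac f /\ d = dderiv2 (Omega f))).

(* Main.v *)
Require Import Defs.
From Stdlib Require Import Reals ClassicalEpsilon FunctionalExtensionality Lra Lia Psatz.
From Coquelicot Require Import Coquelicot.
Open Scope R_scope.

(* The norms on C_c and D_c are transported from A_c, so everything reduces to the completeness of
   B_c and to the injectivity of the linear maps F |-> F' and f |-> Omega_f''.  Both injectivity
   statements are obtained by testing against Gaussians.

   If F' = 0, the test functions exp(-m (t-x)^2) give int F(t) (t-x) exp(-m (t-x)^2) dt = 0 for all
   x and m > 0.  Hence the convolution of F with each Gaussian is constant, so F, its limit as
   m -> oo, is constant, and F = 0 because F(-oo) = 0.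

   The pairing of Omega_f'' with phi is, by Fubini, - int F(t) J(t) dt with
   J(t) = int phi''(s) (d/dt) v_s(t) ds.  As (d/ds)^2 (d/dt) v_s(t) = - i s exp(-ist), two
   integrations by parts give J(t) = int phi(s) (- i s) exp(-ist) ds, the derivative of the Fourier
   transform of phi.  For phi(s) = exp(-l s^2) cos(xs) and exp(-l s^2) sin(xs) this is a combination
   of (t+x) exp(-(t+x)^2/4l) and (t-x) exp(-(t-x)^2/4l), so Omega_f'' = 0 leads to the same
   orthogonality relations as F' = 0. *)

(** * Improper integrals of functions dominated by 1/(1+x^2) *)

(** Improper integrals are limits of Riemann integrals here, so each exchange of limits is earned by
    the explicit majorant C/(1+x^2), whose primitive is a multiple of atan and whose tails are
    therefore known. Gaussians times polynomials and sinusoids fit this setting: the class is closed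
    under differentiation, and its moments come from integrating a derivative to zero. The obstacle
    in Omega_f'' is that the t-derivative of v_s grows with s and that v_s is defined by cases at t
    = 0. The scaling v_s(t) = s^2 w(st) settles both: w' is continuous and O(1/(1+u^2)), so s^3
    w'(st) is bounded by a polynomial in s over 1+t^2, and phi'' absorbs the polynomial. Test
    functions are real, so exp(ixs) is replaced by cos(xs) and sin(xs). Parity makes J purely real
    for the first and purely imaginary for the second, which decouples the two components of F; the
    two resulting relations together isolate the Gaussian centred at x. Injectivity is also what
    makes the norms of C_c and D_c, defined through a chosen preimage, independent of the choice. *)

Definition is_int (f : R -> R) (l : R) : Prop :=
  is_RInt_gen f (Rbar_locally m_infty) (Rbar_locally p_infty) l.

Definition int (f : R -> R) : R :=
  RInt_gen (V := R_CompleteNormedModule) f (Rbar_locally m_infty) (Rbar_locally p_infty).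

Lemma is_int_unique f l : is_int f l -> int f = l.
Proof. exact (is_RInt_gen_unique (V := R_CompleteNormedModule) f l). Qed.

Lemma is_int_ext f g l : (forall x, f x = g x) -> is_int f l -> is_int g l.
Proof.
  intros E. refine (is_RInt_gen_ext f g l _).
  apply filter_forall. intros ab x _. apply E.
Qed.

Lemma is_int_derive (G g : R -> R) (la lb : R) :
  (forall x, is_derive G x (g x)) -> (forall x, continuous g x) ->
  filterlim G (Rbar_locally m_infty) (locally la) ->
  filterlim G (Rbar_locally p_infty) (locally lb) ->
  is_int g (lb - la).
Proof.
  intros D Cg La Lb.
  apply (is_int_ext (Derive G)).
  { intros x. apply is_derive_unique, D. }
  refine (is_RInt_gen_Derive G la lb _ _ La Lb).
  - apply filter_forall. intros ab x _. exists (g x). apply D.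
  - apply filter_forall. intros ab x _.
    apply continuous_ext with g; [|apply Cg].
    intros y. symmetry. apply is_derive_unique, D.
Qed.

Lemma atan_le x y : x <= y -> atan x <= atan y.
Proof. intros [H|H]; [left; now apply atan_increasing | subst; lra]. Qed.

Lemma lim_atan_p_infty : filterlim atan (Rbar_locally p_infty) (locally (PI / 2)).
Proof.
  intros P [e He]. 
  (* The cap 1 < PI/2 keeps [PI / 2 - d] in the range where [atan] inverts [tan]. *)
  set (d := Rmin e 1).
  assert (Hd : 0 < d <= 1 /\ d <= e).
  { unfold d. pose proof (cond_pos e). unfold Rmin; destruct Rle_dec; lra. }
  pose proof PI2_1.
  exists (tan (PI / 2 - d)). intros x Hx. apply He.
  change (Rabs (atan x - PI / 2) < e).
  apply atan_increasing in Hx. rewrite atan_tan in Hx by lra.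
  pose proof (atan_bound x). apply Rabs_def1; lra.
Qed.

Lemma lim_atan_m_infty : filterlim atan (Rbar_locally m_infty) (locally (- (PI / 2))).
Proof.
  apply filterlim_ext with (fun x => - atan (- x)).
  { intros x. rewrite atan_opp. ring. }
  apply (filterlim_comp _ _ _ (fun x => atan (- x)) Ropp _ (locally (PI / 2))).
  - apply (filterlim_comp _ _ _ Ropp atan _ (Rbar_locally p_infty)).
    + apply (filterlim_Rbar_opp m_infty).
    + apply lim_atan_p_infty.
  - apply (filterlim_opp (PI / 2)).
Qed.

(** This majorant is chosen because its primitive is a multiple of [atan], which has finite limits
    at both ends: tails of the integral are bounded by C times tails of [atan], with the same C for
    a whole family of functions. *)
Definition dominated (C : R) (f : R -> R) : Prop :=
  forall x, Rabs (f x) <= C / (1 + x ^ 2).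

Definition dom (f : R -> R) : Prop :=
  (forall x, continuous f x) /\ exists C, dominated C f.

Lemma dominated_nonneg C f : dominated C f -> 0 <= C.
Proof.
  intros H. specialize (H 0). pose proof (Rabs_pos (f 0)).
  replace (C / (1 + 0 ^ 2)) with C in H by field. lra.
Qed.

Lemma ex_RInt_cont (f : R -> R) a b : (forall x, continuous f x) -> ex_RInt f a b.
Proof. intros H. apply (ex_RInt_continuous (V := R_CompleteNormedModule)). intros; apply H. Qed.

Lemma RInt_atan C a b : RInt (fun x => C / (1 + x ^ 2)) a b = C * (atan b - atan a).
Proof.
  apply is_RInt_unique.
  replace (C * (atan b - atan a)) with (minus (C * atan b) (C * atan a))
    by (unfold minus, plus, opp; simpl; ring).
  apply (is_RInt_derive (fun x => C * atan x)).
  - intros x _. auto_derive; [auto|]. unfold Rsqr. field. nra.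
  - intros x _. apply (ex_derive_continuous (fun x => C / (1 + x ^ 2))).
    auto_derive. nra.
Qed.

Lemma RInt_dominated C f a b : (forall x, continuous f x) -> dominated C f -> a <= b ->
  Rabs (RInt f a b) <= C * (atan b - atan a).
Proof.
  intros Cf Df Hab. rewrite <- RInt_atan.
  eapply Rle_trans; [apply abs_RInt_le; [easy|now apply ex_RInt_cont]|].
  apply RInt_le; [easy| | |].
  - apply ex_RInt_cont. intros x. now apply continuous_Rabs_comp.
  - apply ex_RInt_cont. intros x.
    apply (ex_derive_continuous (fun x => C / (1 + x ^ 2))). auto_derive. nra.
  - intros; apply Df.
Qed.

Lemma RInt_Chasles_cont (f : R -> R) a b c : (forall x, continuous f x) ->
  RInt f a b + RInt f b c = RInt f a c.
Proof. intros H. apply (RInt_Chasles f); now apply ex_RInt_cont. Qed.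

Lemma RInt_minus_cont (f : R -> R) a b c : (forall x, continuous f x) ->
  RInt f a c - RInt f a b = RInt f b c.
Proof. intros H. rewrite <- (RInt_Chasles_cont f a b c H). ring. Qed.

Lemma RInt_swap_cont (f : R -> R) a b : (forall x, continuous f x) ->
  RInt f b a = - RInt f a b.
Proof.
  intros H. rewrite <- (opp_RInt_swap f a b); [reflexivity|now apply ex_RInt_cont].
Qed.

Lemma is_derive_primitive (f : R -> R) a x : (forall x, continuous f x) ->
  is_derive (RInt f a) x (f x).
Proof.
  intros H. apply is_derive_RInt with a; [|apply H].
  apply filter_forall. intros y. apply RInt_correct, ex_RInt_cont, H.
Qed.

Lemma RInt_dominated_abs C f a b : (forall x, continuous f x) -> dominated C f ->
  Rabs (RInt f a b) <= C * Rabs (atan b - atan a).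
Proof.
  intros Cf Df. destruct (Rle_dec a b) as [H|H].
  - rewrite (Rabs_pos_eq (atan b - atan a)).
    + now apply RInt_dominated.
    + pose proof (atan_le a b H). lra.
  - rewrite (RInt_swap_cont f b a Cf), Rabs_Ropp, Rabs_minus_sym, (Rabs_pos_eq (atan a - atan b)).
    + apply RInt_dominated; try easy. lra.
    + assert (b <= a) as H' by lra. pose proof (atan_le b a H'). lra.
Qed.

(** The increments of the primitive are at most C times those of [atan], so the Cauchy criterion
    passes from [atan] to the primitive. An arbitrary filter [F] lets one proof serve both
    infinities. *)
Lemma primitive_lim C f (F : (R -> Prop) -> Prop) L : ProperFilter F ->
  (forall x, continuous f x) -> dominated C f ->
  filterlim atan F (locally L) ->
  exists l : R, filterlim (RInt f 0) F (locally l) /\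
    forall a, Rabs (l - RInt f 0 a) <= C * Rabs (L - atan a).
Proof.
  intros PF Cf Df HL.
  pose proof (dominated_nonneg _ _ Df) as HC.
  destruct (proj1 (filterlim_locally_cauchy (U := R_CompleteSpace) (RInt f 0))) as [l Hl].
  - intros eps.
    assert (He : 0 < eps / (C + 1)) by (apply Rdiv_lt_0_compat; [apply cond_pos|lra]).
    destruct (proj2 (filterlim_locally_cauchy (U := R_CompleteSpace) (F := F) atan) (ex_intro _ L HL) (mkposreal _ He))
      as [P [FP HP]].
    exists P; split; [exact FP|]. intros u v Pu Pv.
    specialize (HP u v Pu Pv). change (Rabs (atan v - atan u) < eps / (C + 1)) in HP.
    change (Rabs (RInt f 0 v - RInt f 0 u) < eps).
    rewrite (RInt_minus_cont f 0 u v Cf).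
    eapply Rle_lt_trans; [apply (RInt_dominated_abs C); assumption|].
    apply Rle_lt_trans with ((C + 1) * Rabs (atan v - atan u)).
    { pose proof (Rabs_pos (atan v - atan u)). nra. }
    replace (pos eps) with ((C + 1) * (eps / (C + 1))) by (field; lra).
    apply Rmult_lt_compat_l; [lra|exact HP].
  - exists l; split; [exact Hl|]. intros a.
    change (Rbar_le (Rabs (l - RInt f 0 a)) (C * Rabs (L - atan a))).
    apply (filterlim_le (F := F) (fun b => Rabs (RInt f 0 b - RInt f 0 a))
      (fun b => C * Rabs (atan b - atan a))).
    + apply filter_forall. intros b.
      rewrite (RInt_minus_cont f 0 a b Cf).
      now apply RInt_dominated_abs.
    + simpl. apply (filterlim_comp _ _ _ (RInt f 0) (fun y => Rabs (y - RInt f 0 a)) _ (locally l)); [exact Hl|].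
      apply (continuous_Rabs_comp (fun y => y - RInt f 0 a) l).
      apply (ex_derive_continuous (fun y => y - RInt f 0 a)). auto_derive. auto.
    + simpl. apply (filterlim_comp _ _ _ atan (fun y => C * Rabs (y - atan a)) _ (locally L)); [exact HL|].
      apply (continuous_scal_r C (fun y => Rabs (y - atan a)) L).
      apply (continuous_Rabs_comp (fun y => y - atan a) L).
      apply (ex_derive_continuous (fun y => y - atan a)). auto_derive. auto.
Qed.

(** The truncation error depends on f only through C. This uniformity is what later makes parametric
    integrals continuous and Fubini's theorem pass to the limit. *)
Lemma int_correct_trunc C f : (forall x, continuous f x) -> dominated C f ->
  is_int f (int f) /\
  forall a b, Rabs (int f - RInt f a b) <= C * ((PI / 2 - atan b) + (PI / 2 + atan a)).
Proof.
  intros Cf Df.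
  pose proof (dominated_nonneg _ _ Df) as HC.
  destruct (primitive_lim C f _ _ _ Cf Df lim_atan_p_infty) as [lp [Hp Bp]].
  destruct (primitive_lim C f _ _ _ Cf Df lim_atan_m_infty) as [lm [Hm Bm]].
  assert (H : is_int f (lp - lm)).
  { apply (is_int_derive (RInt f 0)); try assumption.
    intros x. now apply is_derive_primitive. }
  rewrite (is_int_unique _ _ H). split; [exact H|]. intros a b.
  rewrite <- (RInt_minus_cont f 0 a b Cf).
  specialize (Bp b). specialize (Bm a).
  pose proof (atan_bound a). pose proof (atan_bound b).
  rewrite (Rabs_pos_eq (PI / 2 - atan b)) in Bp by lra.
  rewrite (Rabs_left1 (- (PI / 2) - atan a)) in Bm by lra.
  replace (lp - lm - (RInt f 0 b - RInt f 0 a))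
    with ((lp - RInt f 0 b) + - (lm - RInt f 0 a)) by ring.
  eapply Rle_trans; [apply Rabs_triang|]. rewrite Rabs_Ropp. lra.
Qed.

Lemma int_correct f : dom f -> is_int f (int f).
Proof. intros [Cf [C Df]]. now apply (int_correct_trunc C). Qed.

Lemma int_trunc C f a b : (forall x, continuous f x) -> dominated C f ->
  Rabs (int f - RInt f a b) <= C * ((PI / 2 - atan b) + (PI / 2 + atan a)).
Proof. intros Cf Df. now apply int_correct_trunc. Qed.

Lemma int_bound C f : (forall x, continuous f x) -> dominated C f -> Rabs (int f) <= C * PI.
Proof.
  (* Truncating to the degenerate interval from 0 to 0 leaves only the two tails, of total weight
     PI. *)
  intros Cf Df. pose proof (int_trunc C f 0 0 Cf Df) as H.
  rewrite RInt_point, atan_0 in H. change (zero : R) with 0 in H.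
  rewrite Rminus_0_r in H. lra.
Qed.

Lemma is_lim_seq_atan_INR : is_lim_seq (fun n => atan (INR n)) (PI / 2).
Proof.
  apply (filterlim_comp _ _ _ INR atan eventually (Rbar_locally p_infty)).
  - apply is_lim_seq_INR.
  - apply lim_atan_p_infty.
Qed.

Lemma is_lim_seq_tail C : is_lim_seq (fun n => C * (PI - 2 * atan (INR n))) 0.
Proof.
  replace (Finite 0) with (Rbar_mult C (PI - 2 * (PI / 2))) by (simpl; f_equal; field).
  apply is_lim_seq_scal_l.
  apply is_lim_seq_minus'; [apply is_lim_seq_const|].
  apply (is_lim_seq_scal_l _ 2 (PI / 2)), is_lim_seq_atan_INR.
Qed.

Lemma int_trunc_sym C f n : (forall x, continuous f x) -> dominated C f ->
  Rabs (int f - RInt f (- INR n) (INR n)) <= C * (PI - 2 * atan (INR n)).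
Proof.
  intros Cf Df. eapply Rle_trans; [now apply (int_trunc C)|].
  rewrite atan_opp. lra.
Qed.

Lemma is_lim_seq_close (u v w : nat -> R) (l : R) :
  (forall n, Rabs (u n - v n) <= w n) -> is_lim_seq w 0 -> is_lim_seq v l -> is_lim_seq u l.
Proof.
  intros H Hw Hv.
  apply is_lim_seq_ext with (fun n => v n + (u n - v n)); [intros; ring|].
  replace (Finite l) with (Finite (l + 0)) by (f_equal; ring).
  apply is_lim_seq_plus'; [exact Hv|].
  apply is_lim_seq_abs_0. 
  apply is_lim_seq_le_le with (fun _ => 0) w; [|apply is_lim_seq_const|exact Hw].
  intros n; split; [apply Rabs_pos|apply H].
Qed.

Lemma int_lim_seq f : dom f ->
  is_lim_seq (fun n => RInt f (- INR n) (INR n)) (int f).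
Proof.
  intros [Cf [C Df]].
  apply is_lim_seq_close with (fun _ => int f) (fun n => C * (PI - 2 * atan (INR n))).
  - intros n. rewrite Rabs_minus_sym. now apply int_trunc_sym.
  - apply is_lim_seq_tail.
  - apply is_lim_seq_const.
Qed.

Lemma dom_plus f g : dom f -> dom g -> dom (fun x => f x + g x).
Proof.
  intros [Cf [C Df]] [Cg [D Dg]]. split.
  - intros x. apply (continuous_plus f g x); auto.
  - exists (C + D). intros x. eapply Rle_trans; [apply Rabs_triang|].
    specialize (Df x). specialize (Dg x). unfold Rdiv in *. lra.
Qed.

Lemma dom_scal k f : dom f -> dom (fun x => k * f x).
Proof.
  intros [Cf [C Df]]. split.
  - intros x. apply (continuous_scal_r k f x); auto.
  - exists (Rabs k * C). intros x. rewrite Rabs_mult.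
    specialize (Df x). unfold Rdiv in *. rewrite Rmult_assoc.
    apply Rmult_le_compat_l; [apply Rabs_pos|assumption].
Qed.

Lemma dom_ext f g : (forall x, f x = g x) -> dom f -> dom g.
Proof. intros E. now rewrite (functional_extensionality f g E). Qed.

Lemma dom_minus f g : dom f -> dom g -> dom (fun x => f x - g x).
Proof.
  intros Hf Hg. apply dom_ext with (fun x => f x + (-1) * g x).
  - intros; ring.
  - apply dom_plus; [easy|]. now apply dom_scal.
Qed.

Lemma int_ext f g : (forall x, f x = g x) -> int f = int g.
Proof. intros E. now rewrite (functional_extensionality f g E). Qed.

Lemma int_plus f g : dom f -> dom g -> int (fun x => f x + g x) = int f + int g.
Proof.
  intros Hf Hg. apply is_int_unique.
  apply (is_RInt_gen_plus f g); now apply int_correct.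
Qed.

Lemma int_scal k f : dom f -> int (fun x => k * f x) = k * int f.
Proof.
  intros Hf. apply is_int_unique.
  apply (is_RInt_gen_scal f k); now apply int_correct.
Qed.

Lemma int_minus f g : dom f -> dom g -> int (fun x => f x - g x) = int f - int g.
Proof.
  intros Hf Hg. apply is_int_unique.
  apply (is_RInt_gen_minus f g); now apply int_correct.
Qed.

Lemma int_ge_RInt f (a b : R) : dom f -> (forall x, 0 <= f x) -> a <= b -> RInt f a b <= int f.
Proof.
  intros Hf Pf Hab.
  change (Rbar_le (RInt f a b) (int f)).
  refine (is_lim_seq_le_loc _ _ _ _ _ (is_lim_seq_const (RInt f a b)) (int_lim_seq f Hf)).
  destruct Hf as [Cf _].
  destruct (nfloor_ex (Rabs a + Rabs b)) as [N HN].
  { pose proof (Rabs_pos a); pose proof (Rabs_pos b); lra. }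
  exists (S N). intros n Hn. apply le_INR in Hn. rewrite S_INR in Hn.
  pose proof (Rabs_maj2 a); pose proof (Rle_abs b). pose proof (Rle_abs a). pose proof (Rabs_maj2 b).
  pose proof (Rabs_pos a); pose proof (Rabs_pos b).
  rewrite <- (RInt_Chasles_cont f (- INR n) a (INR n) Cf).
  rewrite <- (RInt_Chasles_cont f a b (INR n) Cf).
  assert (0 <= RInt f (- INR n) a) by (apply RInt_ge_0; [lra|now apply ex_RInt_cont|auto]).
  assert (0 <= RInt f b (INR n)) by (apply RInt_ge_0; [lra|now apply ex_RInt_cont|auto]).
  lra.
Qed.

Lemma int_pos f : dom f -> (forall x, 0 < f x) -> 0 < int f.
Proof.
  intros Hf Pf. apply Rlt_le_trans with (RInt f 0 1).
  - apply RInt_gt_0; [lra|auto|]. intros; apply Hf.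
  - apply int_ge_RInt; [easy| |lra]. intros; left; auto.
Qed.

Lemma int_ge_0 f : dom f -> (forall x, 0 <= f x) -> 0 <= int f.
Proof.
  intros Hf Pf. pose proof (int_ge_RInt f 0 0 Hf Pf (Rle_refl 0)) as H.
  now rewrite RInt_point in H.
Qed.

Lemma int_le f g : dom f -> dom g -> (forall x, f x <= g x) -> int f <= int g.
Proof.
  intros Hf Hg H.
  assert (0 <= int (fun x => g x - f x)).
  { apply int_ge_0; [now apply dom_minus|]. intros x; specialize (H x); lra. }
  rewrite int_minus in H0 by easy. lra.
Qed.

Lemma int_abs_le f g : dom f -> dom g -> (forall x, Rabs (f x) <= g x) -> Rabs (int f) <= int g.
Proof.
  intros Hf Hg H. apply Rabs_le. split.
  - replace (- int g) with (int (fun x => (-1) * g x)) by (rewrite int_scal by easy; ring).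
    apply int_le; [now apply dom_scal|easy|]. intros x; specialize (H x). apply Rabs_le_between in H; lra.
  - apply int_le; try easy. intros x; specialize (H x). apply Rabs_le_between in H; lra.
Qed.

(** * Parametric integrals and Fubini's theorem *)

Definition cont2 (f : R -> R -> R) : Prop :=
  forall z : R * R, continuous (fun z => f (fst z) (snd z)) z.

Lemma cont2_comp (f : R -> R -> R) (U : UniformSpace) (g h : U -> R) x : cont2 f ->
  continuous g x -> continuous h x -> continuous (fun y => f (g y) (h y)) x.
Proof. intros H Hg Hh. apply (continuous_comp_2 g h f x Hg Hh). apply H. Qed.

Lemma cont2_l f t : cont2 f -> forall s, continuous (fun s => f s t) s.
Proof.
  intros H s. apply (cont2_comp f R_UniformSpace (fun s => s) (fun _ => t)).
  - exact H.
  - apply continuous_id.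
  - apply continuous_const.
Qed.

Lemma cont2_r f s : cont2 f -> forall t, continuous (f s) t.
Proof.
  intros H t. apply (cont2_comp f R_UniformSpace (fun _ => s) (fun t => t)).
  - exact H.
  - apply continuous_const.
  - apply continuous_id.
Qed.

Lemma cont2_swap f : cont2 f -> cont2 (fun t s => f s t).
Proof.
  intros H z. apply (cont2_comp f _ snd fst); [easy| |].
  - apply continuous_snd.
  - apply continuous_fst.
Qed.

Lemma cont2_pt f s t : cont2 f -> continuity_2d_pt f s t.
Proof. intros H. apply continuity_2d_pt_filterlim. apply (H (s, t)). Qed.

Lemma continuous_eps (f : R -> R) x :
  (forall eps, 0 < eps -> exists d, 0 < d /\ forall y, Rabs (y - x) < d -> Rabs (f y - f x) < eps) ->
  continuous f x.
Proof.
  intros H P [e He]. destruct (H e (cond_pos e)) as [d [Hd K]].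
  exists (mkposreal d Hd). intros y Hy. apply He. now apply K.
Qed.

Lemma continuous_eps_inv (f : R -> R) x : continuous f x ->
  forall eps, 0 < eps -> exists d, 0 < d /\ forall y, Rabs (y - x) < d -> Rabs (f y - f x) < eps.
Proof.
  intros H eps He.
  destruct (H _ (locally_ball (f x) (mkposreal eps He))) as [d Hd].
  exists d; split; [apply cond_pos|]. intros y Hy. apply (Hd y Hy).
Qed.

Lemma continuous_RInt_param f a b s0 : cont2 f -> continuous (fun s => RInt (f s) a b) s0.
Proof.
  intros Cf.
  assert (K : forall a b, a <= b -> continuous (fun s => RInt (f s) a b) s0).
  { clear a b. intros a b Hab. apply continuous_eps. intros eps He.
    assert (He' : 0 < eps / (b - a + 1)) by (apply Rdiv_lt_0_compat; lra).
    destruct (uniform_continuity_2d f (s0 - 1) (s0 + 1) a b) with (mkposreal _ He') as [d Hd].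
    { intros; now apply cont2_pt. }
    exists (Rmin 1 d). split; [apply Rmin_glb_lt; [lra|apply cond_pos]|].
    intros s Hs. apply Rmin_Rgt in Hs as [H1 H2].
    apply Rabs_def2 in H1.
    rewrite <- (RInt_minus (f s) (f s0)) by (apply ex_RInt_cont, cont2_r, Cf).
    apply Rle_lt_trans with ((b - a) * (eps / (b - a + 1))).
    - apply abs_RInt_le_const; [easy| |].
      + apply (ex_RInt_minus (f s) (f s0)); apply ex_RInt_cont, cont2_r, Cf.
      + intros t Ht. left. apply Hd; try lra; try easy.
        rewrite Rminus_diag, Rabs_R0. apply cond_pos.
    - apply Rlt_le_trans with ((b - a + 1) * (eps / (b - a + 1))); [nra|].
      right; field; lra. }
  destruct (Rle_dec a b) as [H|H]; [now apply K|].
  apply continuous_ext with (fun s => - RInt (f s) b a).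
  { intros s. symmetry. apply RInt_swap_cont, cont2_r, Cf. }
  apply (continuous_opp (fun s => RInt (f s) b a)). apply K. lra.
Qed.

Lemma derive_zero_const (f : R -> R) : (forall x, is_derive f x 0) -> forall a b, f a = f b.
Proof.
  intros H.
  assert (K : forall a b, a < b -> f a = f b).
  { intros a b Hab. apply eq_is_derive; [|easy]. intros; apply H. }
  intros a b. destruct (Rtotal_order a b) as [L|[L|L]].
  - now apply K.
  - now subst.
  - symmetry. now apply K.
Qed.

(** As functions of the upper bound b both sides have the derivative [RInt (f b) c d], the right one
    by differentiation under the integral, and both vanish at b = a. *)
Lemma RInt_RInt_swap f a b c d : cont2 f ->
  RInt (fun s => RInt (f s) c d) a b = RInt (fun t => RInt (fun s => f s t) a b) c d.
Proof.
  intros Cf.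
  set (L := fun b => RInt (fun s => RInt (f s) c d) a b).
  set (G := fun b => RInt (fun t => RInt (fun s => f s t) a b) c d).
  assert (DL : forall x, is_derive L x (RInt (f x) c d)).
  { intros x. apply (is_derive_primitive (fun s => RInt (f s) c d)).
    intros y. now apply continuous_RInt_param. }
  assert (E : forall u v, Derive (fun z => RInt (fun s => f s v) a z) u = f u v).
  { intros u v. apply is_derive_unique. apply (is_derive_primitive (fun s => f s v)).
    now apply cont2_l. }
  assert (DG : forall x, is_derive G x (RInt (f x) c d)).
  { intros x. unfold G.
    replace (RInt (f x) c d) with (RInt (fun t => Derive (fun u => RInt (fun s => f s t) a u) x) c d)
      by (apply RInt_ext; intros; apply E).
    apply (is_derive_RInt_param (fun u t => RInt (fun s => f s t) a u)).
    - apply filter_forall. intros y t _. exists (f y t).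
      apply (is_derive_primitive (fun s => f s t)). now apply cont2_l.
    - intros t _. apply continuity_2d_pt_ext with f; [intros; symmetry; apply E|now apply cont2_pt].
    - apply filter_forall. intros y. apply ex_RInt_cont. intros t.
      apply (continuous_RInt_param (fun t s => f s t)). now apply cont2_swap. }
  assert (Z : L b - G b = L a - G a).
  { apply (derive_zero_const (fun x => L x - G x)). intros x.
    replace 0 with (minus (RInt (f x) c d) (RInt (f x) c d)) by (apply (Rminus_diag)).
    apply (is_derive_minus L G); auto. }
  assert (L a = 0) by apply (RInt_point (V := R_CompleteNormedModule)).
  assert (G a = 0).
  { unfold G. rewrite (RInt_ext _ (fun _ => 0)).
    - rewrite RInt_const. apply Rmult_0_r.
    - intros t _. apply (RInt_point (V := R_CompleteNormedModule)). }
  change (L b = G b). lra.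
Qed.

(** The constant may grow with the range of s, as it must for a Gaussian whose centre moves with s.
    A local constant suffices for continuity in s and for integration over a bounded range of s. *)
Definition loc_dom (f : R -> R -> R) : Prop :=
  forall r, exists C, forall s, Rabs s <= r -> dominated C (f s).

Lemma tail_small C eps : 0 < eps -> exists n, C * (PI - 2 * atan (INR n)) < eps.
Proof.
  intros He. destruct (proj1 (is_lim_seq_Reals _ _) (is_lim_seq_tail C) eps He) as [N HN].
  exists N. specialize (HN N (Nat.le_refl _)). unfold Rdist in HN.
  apply Rabs_def2 in HN. lra.
Qed.

(** An eps/3 argument: near [s0] one constant C controls the tails for all s, so a single truncation
    [-n, n] serves both s and [s0]. *)
Lemma continuous_int_param f s0 : cont2 f -> loc_dom f -> continuous (fun s => int (f s)) s0.
Proof.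
  intros Cf Df. apply continuous_eps. intros eps He.
  destruct (Df (Rabs s0 + 1)) as [C HC].
  destruct (tail_small C (eps / 3)) as [n Hn]; [lra|].
  destruct (continuous_eps_inv _ _ (continuous_RInt_param f (- INR n) (INR n) s0 Cf) (eps / 3))
    as [d [Hd K]]; [lra|].
  exists (Rmin 1 d). split; [now apply Rmin_glb_lt; [lra|]|].
  intros s Hs. apply Rmin_Rgt in Hs as [H1 H2].
  assert (Rabs s <= Rabs s0 + 1).
  { replace s with (s0 + (s - s0)) by ring. eapply Rle_trans; [apply Rabs_triang|]. lra. }
  specialize (K s H2).
  pose proof (int_trunc_sym C (f s) n (cont2_r f s Cf) (HC s ltac:(lra))) as B1.
  pose proof (int_trunc_sym C (f s0) n (cont2_r f s0 Cf) (HC s0 ltac:(lra))) as B2.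
  apply Rabs_def2 in K. apply Rabs_le_between in B1. apply Rabs_le_between in B2.
  apply Rabs_def1; lra.
Qed.

Lemma RInt_abs_bound (f : R -> R) a b M : (forall x, continuous f x) ->
  (forall t, Rabs t <= Rmax (Rabs a) (Rabs b) -> Rabs (f t) <= M) ->
  Rabs (RInt f a b) <= Rabs (b - a) * M.
Proof.
  intros Cf H.
  assert (Pa := Rmax_l (Rabs a) (Rabs b)). assert (Pb := Rmax_r (Rabs a) (Rabs b)).
  apply Rabs_le_between in Pa. apply Rabs_le_between in Pb.
  destruct (Rle_dec a b) as [L|L].
  - rewrite (Rabs_pos_eq (b - a)) by lra.
    apply abs_RInt_le_const; [easy|now apply ex_RInt_cont|].
    intros t Ht. apply H. apply Rabs_le; lra.
  - rewrite (RInt_swap_cont f b a Cf), Rabs_Ropp, (Rabs_left1 (b - a)) by lra.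
    replace (- (b - a)) with (a - b) by ring.
    apply abs_RInt_le_const; [lra|now apply ex_RInt_cont|].
    intros t Ht. apply H. apply Rabs_le; lra.
Qed.

Lemma dom_RInt_param f a b : cont2 f -> loc_dom f -> dom (fun t => RInt (fun s => f s t) a b).
Proof.
  intros Cf Df. split.
  - intros t. apply (continuous_RInt_param (fun t s => f s t)). now apply cont2_swap.
  - destruct (Df (Rmax (Rabs a) (Rabs b))) as [C HC].
    exists (Rabs (b - a) * C). intros t. unfold Rdiv. rewrite Rmult_assoc.
    apply RInt_abs_bound; [now apply cont2_l|]. intros s Hs. now apply HC.
Qed.

(** Fubini on the rectangle with t in [-n, n], then n tends to infinity: the tail in t is uniformly
    small over the bounded range of s, hence so is its integral over that range. *)
Lemma RInt_int_swap f a b : cont2 f -> loc_dom f ->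
  RInt (fun s => int (f s)) a b = int (fun t => RInt (fun s => f s t) a b).
Proof.
  intros Cf Df.
  set (u := fun n => RInt (fun s => RInt (f s) (- INR n) (INR n)) a b).
  enough (L1 : is_lim_seq u (RInt (fun s => int (f s)) a b)).
  { enough (L2 : is_lim_seq u (int (fun t => RInt (fun s => f s t) a b))).
    { apply is_lim_seq_unique in L1. apply is_lim_seq_unique in L2.
      rewrite L1 in L2. now injection L2. }
    eapply is_lim_seq_ext; [|apply int_lim_seq; now apply dom_RInt_param].
    intros n. symmetry. exact (RInt_RInt_swap f a b (- INR n) (INR n) Cf). }
  destruct (Df (Rmax (Rabs a) (Rabs b))) as [C HC].
  apply is_lim_seq_close with (fun _ => RInt (fun s => int (f s)) a b)
    (fun n => Rabs (b - a) * C * (PI - 2 * atan (INR n))).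
  - intros n. rewrite Rabs_minus_sym. unfold u.
    assert (C1 : forall s, continuous (fun s => int (f s)) s) by (intros; now apply continuous_int_param).
    assert (C2 : forall s, continuous (fun s => RInt (f s) (- INR n) (INR n)) s)
      by (intros; now apply continuous_RInt_param).
    rewrite <- (RInt_minus (fun s => int (f s)) (fun s => RInt (f s) (- INR n) (INR n)))
      by now apply ex_RInt_cont.
    rewrite Rmult_assoc. apply RInt_abs_bound.
    + intros s. apply (continuous_minus (fun s => int (f s)) (fun s => RInt (f s) (- INR n) (INR n))); auto.
    + intros s Hs. apply int_trunc_sym; [now apply cont2_r|now apply HC].
  - apply is_lim_seq_tail.
  - apply is_lim_seq_const.
Qed.

(** A product majorant, so that integrating out either variable leaves a function dominated in the
    other. *)
Definition dominated2 (C : R) (f : R -> R -> R) : Prop :=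
  forall s t, Rabs (f s t) <= C / ((1 + s ^ 2) * (1 + t ^ 2)).

Lemma dominated2_r C f s : dominated2 C f -> dominated (C / (1 + s ^ 2)) (f s).
Proof.
  intros H t. replace (C / (1 + s ^ 2) / (1 + t ^ 2)) with (C / ((1 + s ^ 2) * (1 + t ^ 2))).
  - apply H.
  - field. split; nra.
Qed.

Lemma dominated2_swap C f : dominated2 C f -> dominated2 C (fun t s => f s t).
Proof. intros H t s. rewrite Rmult_comm. apply H. Qed.

Lemma dominated2_loc_dom C f : dominated2 C f -> loc_dom f.
Proof.
  intros H r. exists C. intros s _ t.
  assert (0 <= C).
  { specialize (H 0 0). pose proof (Rabs_pos (f 0 0)).
    replace (C / ((1 + 0 ^ 2) * (1 + 0 ^ 2))) with C in H by field. lra. }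
  eapply Rle_trans; [apply H|]. apply Rmult_le_compat_l; [easy|].
  apply Rinv_le_contravar; nra.
Qed.

Lemma dom_int_param C f : cont2 f -> dominated2 C f -> dom (fun s => int (f s)).
Proof.
  intros Cf Df. split.
  - intros s. apply continuous_int_param; [easy|now apply (dominated2_loc_dom C)].
  - exists (C * PI). intros s.
    replace (C * PI / (1 + s ^ 2)) with (C / (1 + s ^ 2) * PI) by (field; nra).
    apply int_bound; [now apply cont2_r|now apply dominated2_r].
Qed.

(** Only the outer integral is truncated, and the half-finite exchange applies to it. For each t the
    error is at most [C * (PI - 2 * atan (INR n)) / (1 + t ^ 2)]; integrating in t costs a factor
    PI. *)
Lemma int_int_swap C f : cont2 f -> dominated2 C f ->
  int (fun s => int (f s)) = int (fun t => int (fun s => f s t)).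
Proof.
  intros Cf Df.
  pose proof (cont2_swap f Cf) as Cf'. pose proof (dominated2_swap C f Df) as Df'.
  set (u := fun n => RInt (fun s => int (f s)) (- INR n) (INR n)).
  assert (L1 : is_lim_seq u (int (fun s => int (f s)))).
  { apply int_lim_seq. now apply (dom_int_param C). }
  enough (L2 : is_lim_seq u (int (fun t => int (fun s => f s t)))).
  { apply is_lim_seq_unique in L1. apply is_lim_seq_unique in L2.
    rewrite L1 in L2. now injection L2. }
  pose proof (dominated2_loc_dom C f Df) as Lf.
  pose proof (dom_int_param C _ Cf' Df') as DI.
  apply is_lim_seq_close with (fun _ => int (fun t => int (fun s => f s t)))
    (fun n => C * PI * (PI - 2 * atan (INR n))).
  - intros n. unfold u. rewrite RInt_int_swap by easy. rewrite Rabs_minus_sym.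
    assert (DR : dom (fun t => RInt (fun s => f s t) (- INR n) (INR n))) by now apply dom_RInt_param.
    rewrite <- int_minus by easy.
    replace (C * PI * (PI - 2 * atan (INR n))) with (C * (PI - 2 * atan (INR n)) * PI) by ring.
    apply int_bound.
    + apply dom_minus; easy.
    + intros t.
      replace (C * (PI - 2 * atan (INR n)) / (1 + t ^ 2))
        with (C / (1 + t ^ 2) * (PI - 2 * atan (INR n))) by (field; nra).
      apply int_trunc_sym; [now apply cont2_l|].
      exact (dominated2_r C (fun t s => f s t) t Df').
  - apply is_lim_seq_tail.
  - apply is_lim_seq_const.
Qed.

(** * Rapidly decreasing functions and Gaussian test functions *)

(** The only property of the filter that matters is that it leaves every bounded set, so both
    infinities are treated at once. *)
Lemma lim_abs_inv (F : (R -> Prop) -> Prop) (f : R -> R) C : Filter F ->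
  (forall M, F (fun x => M < Rabs x)) -> dominated C f -> filterlim f F (locally 0).
Proof.
  intros FF HF Df P [e He]. unfold filtermap.
  pose proof (dominated_nonneg _ _ Df) as HC.
  generalize (HF (Rmax 1 (C / e))). apply filter_imp.
  intros x Hx. apply He. change (Rabs (f x - 0) < e). rewrite Rminus_0_r.
  eapply Rle_lt_trans; [apply Df|].
  pose proof (Rmax_l 1 (C / e)). pose proof (Rmax_r 1 (C / e)). pose proof (cond_pos e).
  assert (K : C / e < Rabs x) by lra.
  apply (Rmult_lt_compat_r e) in K; [|easy]. unfold Rdiv in K at 1.
  rewrite Rmult_assoc, Rinv_l, Rmult_1_r in K by lra.
  assert (K2 : 1 + x ^ 2 > Rabs x) by (rewrite <- (pow2_abs x); nra).
  apply Rmult_lt_reg_r with (1 + x ^ 2); [nra|].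
  unfold Rdiv. rewrite Rmult_assoc, Rinv_l, Rmult_1_r by nra. nra.
Qed.

Lemma far_p_infty M : Rbar_locally p_infty (fun x => M < Rabs x).
Proof. exists M. intros x Hx. pose proof (Rle_abs x). lra. Qed.

Lemma far_m_infty M : Rbar_locally m_infty (fun x => M < Rabs x).
Proof. exists (- M). intros x Hx. pose proof (Rabs_maj2 x). lra. Qed.

Lemma dominated_lim_p_infty C f : dominated C f -> filterlim f (Rbar_locally p_infty) (locally 0).
Proof. apply lim_abs_inv; [apply Rbar_locally_filter|apply far_p_infty]. Qed.

Lemma dominated_lim_m_infty C f : dominated C f -> filterlim f (Rbar_locally m_infty) (locally 0).
Proof. apply lim_abs_inv; [apply Rbar_locally_filter|apply far_m_infty]. Qed.

Lemma int_derive_zero (G g : R -> R) : dom G -> (forall x, is_derive G x (g x)) ->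
  (forall x, continuous g x) -> int g = 0.
Proof.
  intros [_ [C DG]] H Cg. apply is_int_unique.
  replace 0 with (0 - 0) by ring.
  apply (is_int_derive G); try easy.
  - now apply dominated_lim_m_infty with C.
  - now apply dominated_lim_p_infty with C.
Qed.

Definition rapid (f : R -> R) : Prop := forall k : nat, exists M, forall x, Rabs (x ^ k * f x) <= M.

(** The weights (1+x^2)^k are at least 1 and multiply by adding exponents, so sums and products of
    such functions are handled without separating small and large x. *)
Definition pgrow (g : R -> R) : Prop :=
  exists (k : nat) C, forall x, Rabs (g x) <= C * (1 + x ^ 2) ^ k.

Lemma rapid_weight k : forall f, rapid f -> rapid (fun x => (1 + x ^ 2) ^ k * f x).
Proof.
  induction k as [|k IH]; intros f H.
  - intros j. destruct (H j) as [M HM]. exists M. intros x. specialize (HM x). simpl. now rewrite Rmult_1_l.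
  - specialize (IH f H). intros j.
    destruct (IH j) as [M1 H1]. destruct (IH (S (S j))) as [M2 H2].
    exists (M1 + M2). intros x. specialize (H1 x). specialize (H2 x).
    replace (x ^ j * ((1 + x ^ 2) ^ S k * f x)) with
      (x ^ j * ((1 + x ^ 2) ^ k * f x) + x ^ S (S j) * ((1 + x ^ 2) ^ k * f x)) by (simpl; ring).
    eapply Rle_trans; [apply Rabs_triang|]. lra.
Qed.

Lemma rapid_mult_pgrow f g : rapid f -> pgrow g -> rapid (fun x => f x * g x).
Proof.
  intros Hf [k [C Hg]] j. destruct (rapid_weight k f Hf j) as [M HM].
  exists (M * C). intros x. specialize (HM x). specialize (Hg x).
  rewrite <- Rmult_assoc, Rabs_mult.
  assert (0 < (1 + x ^ 2) ^ k) by (apply pow_lt; nra).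
  rewrite (Rmult_comm _ (f x)), <- Rmult_assoc, Rabs_mult, (Rabs_pos_eq ((1 + x ^ 2) ^ k)) in HM by lra.
  assert (0 <= C).
  { pose proof (Rabs_pos (g x)). apply Rmult_le_reg_r with ((1 + x ^ 2) ^ k); [easy|]. lra. }
  pose proof (Rabs_pos (x ^ j * f x)). pose proof (Rabs_pos (g x)).
  apply Rle_trans with (Rabs (x ^ j * f x) * (C * (1 + x ^ 2) ^ k)); nra.
Qed.

Lemma rapid_dominated f : rapid f -> exists C, dominated C f.
Proof.
  intros H. destruct (rapid_weight 1 f H 0%nat) as [M HM].
  exists M. intros x. specialize (HM x).
  rewrite pow_O, Rmult_1_l, pow_1, Rabs_mult, (Rabs_pos_eq (1 + x ^ 2)) in HM by nra.
  apply Rmult_le_reg_r with (1 + x ^ 2); [nra|].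
  unfold Rdiv. rewrite Rmult_assoc, Rinv_l, Rmult_1_r by nra. lra.
Qed.

Lemma rapid_dom f : (forall x, continuous f x) -> rapid f -> dom f.
Proof. intros Cf Hf. split; [easy|]. now apply rapid_dominated. Qed.

Lemma rapid_plus f g : rapid f -> rapid g -> rapid (fun x => f x + g x).
Proof.
  intros Hf Hg k. destruct (Hf k) as [M HM]. destruct (Hg k) as [N HN].
  exists (M + N). intros x. rewrite Rmult_plus_distr_l.
  eapply Rle_trans; [apply Rabs_triang|]. specialize (HM x). specialize (HN x). lra.
Qed.

Lemma pgrow_bounded g C : (forall x, Rabs (g x) <= C) -> pgrow g.
Proof. intros H. exists 0%nat, C. intros x. simpl. specialize (H x). lra. Qed.

Lemma pgrow_mult f g : pgrow f -> pgrow g -> pgrow (fun x => f x * g x).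
Proof.
  intros [k [C Hf]] [j [D Hg]]. exists (k + j)%nat, (C * D). intros x.
  specialize (Hf x). specialize (Hg x). rewrite Rabs_mult, pow_add.
  replace (C * D * ((1 + x ^ 2) ^ k * (1 + x ^ 2) ^ j)) with
    ((C * (1 + x ^ 2) ^ k) * (D * (1 + x ^ 2) ^ j)) by ring.
  apply Rmult_le_compat; auto using Rabs_pos.
Qed.

Lemma pgrow_id : pgrow (fun x => x).
Proof.
  exists 1%nat, 1. intros x. rewrite pow_1, Rmult_1_l. apply Rabs_le. nra.
Qed.

Lemma pgrow_pow n : pgrow (fun x => x ^ n).
Proof.
  induction n as [|n IH].
  - apply pgrow_bounded with 1. intros; simpl. rewrite Rabs_R1. lra.
  - apply (pgrow_mult _ _ pgrow_id IH).
Qed.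

Lemma pgrow_plus f g : pgrow f -> pgrow g -> pgrow (fun x => f x + g x).
Proof.
  intros [k [C Hf]] [j [D Hg]].
  exists (k + j)%nat, (Rabs C + Rabs D). intros x. specialize (Hf x). specialize (Hg x).
  eapply Rle_trans; [apply Rabs_triang|].
  rewrite pow_add.
  assert (K : forall n, 1 <= (1 + x ^ 2) ^ n) by (intros n; apply pow_R1_Rle; nra).
  pose proof (K k). pose proof (K j).
  assert (C * (1 + x ^ 2) ^ k <= Rabs C * ((1 + x ^ 2) ^ k * (1 + x ^ 2) ^ j)).
  { eapply Rle_trans; [apply Rmult_le_compat_r; [lra|apply Rle_abs]|].
    apply Rmult_le_compat_l; [apply Rabs_pos|]. nra. }
  assert (D * (1 + x ^ 2) ^ j <= Rabs D * ((1 + x ^ 2) ^ k * (1 + x ^ 2) ^ j)).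
  { eapply Rle_trans; [apply Rmult_le_compat_r; [lra|apply Rle_abs]|].
    apply Rmult_le_compat_l; [apply Rabs_pos|]. nra. }
  lra.
Qed.

Lemma pgrow_const c : pgrow (fun _ => c).
Proof. now apply pgrow_bounded with (Rabs c). Qed.

Lemma exp_pow_INR n u : exp u ^ n = exp (INR n * u).
Proof.
  induction n as [|n IH]; [simpl; now rewrite Rmult_0_l, exp_0|].
  rewrite S_INR, Rmult_plus_distr_r, exp_plus, Rmult_1_l, <- IH. simpl. ring.
Qed.

(** Take 1 + u <= exp u at u = a t^2 / N and raise it to the power N = n + 1, which is positive even
    when n = 0. The constant 1 + N/a is what makes (1 + N/a)(1 + a t^2/N) at least 1 + t^2. *)
Lemma pow_one_plus_sq_exp n a : 0 < a -> exists c, forall t : R, (1 + t ^ 2) ^ n <= c * exp (a * t ^ 2).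
Proof.
  intros Ha. set (N := INR (S n)).
  assert (HN : 1 <= N) by (unfold N; rewrite S_INR; pose proof (pos_INR n); lra).
  set (c := 1 + N / a).
  assert (Hc : 1 <= c).
  { assert (0 < N / a) by (apply Rdiv_lt_0_compat; lra). unfold c; lra. }
  exists (c ^ S n). intros t.
  assert (1 + t ^ 2 <= c * exp (a * t ^ 2 / N)).
  { pose proof (exp_ineq1_le (a * t ^ 2 / N)).
    apply Rle_trans with (c * (1 + a * t ^ 2 / N)); [|nra].
    unfold c. replace ((1 + N / a) * (1 + a * t ^ 2 / N)) with
      (1 + N / a + a * t ^ 2 / N + t ^ 2) by (field; lra).
    assert (0 < N / a) by (apply Rdiv_lt_0_compat; lra).
    assert (0 <= a * t ^ 2 / N) by (apply Rdiv_le_0_compat; nra). lra. }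
  assert (P : 0 < 1 + t ^ 2) by nra.
  apply Rle_trans with ((1 + t ^ 2) ^ S n).
  { apply Rle_pow; [nra|lia]. }
  eapply Rle_trans; [apply pow_incr; split; [lra|exact H]|].
  rewrite Rpow_mult_distr. apply Rmult_le_compat_l; [apply pow_le; lra|].
  right. rewrite exp_pow_INR. f_equal. fold N. field. lra.
Qed.

(** The linear term [m * t] accommodates shifted Gaussians, with [m] replaced by 2mx for centre x.
    The phase [z] accommodates sines, with [z = - PI / 2], and lets differentiation act as a phase
    shift. *)
Definition gauss_base (l m y : R) (k : nat) (z t : R) : R :=
  t ^ k * exp (- l * t ^ 2 + m * t) * cos (y * t + z).

(** The linear span for fixed l, m, y. Closure under differentiation reduces all the Schwartz
    conditions to rapid decrease of the generators. *)
Inductive gauss_poly (l m y : R) : (R -> R) -> Prop :=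
| gp_base k z : gauss_poly l m y (gauss_base l m y k z)
| gp_plus f g : gauss_poly l m y f -> gauss_poly l m y g -> gauss_poly l m y (fun t => f t + g t)
| gp_scal c f : gauss_poly l m y f -> gauss_poly l m y (fun t => c * f t).

Lemma gauss_poly_is_derive l m y f : gauss_poly l m y f ->
  exists g, gauss_poly l m y g /\ forall x, is_derive f x (g x).
Proof.
  induction 1 as [k z|f1 f2 _ [g1 [G1 D1]] _ [g2 [G2 D2]]|c f _ [g [G D]]].
  (* The derivative of the cosine is a shift of its phase by PI/2. For k = 0 the truncated [pred k]
     is harmless because its coefficient [INR k] is 0. *)
  - exists (fun t => INR k * gauss_base l m y (pred k) z t +
      ((-2 * l) * gauss_base l m y (S k) z t + (m * gauss_base l m y k z t +
       y * gauss_base l m y k (z + PI / 2) t))).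
    split; [repeat (apply gp_plus || apply gp_scal || apply gp_base)|].
    intros x. unfold gauss_base. auto_derive; [auto|].
    replace (y * x + (z + PI / 2)) with ((y * x + z) + PI / 2) by ring.
    rewrite (cos_plus (y * x + z)), cos_PI2, sin_PI2. simpl pow. ring.
  - exists (fun t => g1 t + g2 t). split; [now apply gp_plus|].
    intros x. apply (is_derive_plus f1 f2); auto.
  - exists (fun t => c * g t). split; [now apply gp_scal|].
    intros x. apply (is_derive_scal f); auto.
Qed.

Lemma gauss_poly_Derive_n l m y f n : gauss_poly l m y f -> gauss_poly l m y (Derive_n f n).
Proof.
  intros H. induction n as [|n IH]; [exact H|].
  destruct (gauss_poly_is_derive _ _ _ _ IH) as [g [G D]].
  replace (Derive_n f (S n)) with g; [easy|].
  apply functional_extensionality. intros x. symmetry. apply is_derive_unique, D.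
Qed.

Lemma gauss_poly_continuous l m y f x : gauss_poly l m y f -> continuous f x.
Proof.
  intros H. destruct (gauss_poly_is_derive _ _ _ _ H) as [g [G D]].
  apply (ex_derive_continuous f). exists (g x). apply D.
Qed.

(** Half of the quadratic exponent absorbs the linear term: completing the square gives -l x^2 + m x
    <= m^2/(2l) - (l/2) x^2. The remaining half absorbs the power of x. *)
Lemma gauss_base_rapid l m y k z : 0 < l -> rapid (gauss_base l m y k z).
Proof.
  intros Hl j. destruct (pow_one_plus_sq_exp (j + k) (l / 2)) as [c Hc]; [lra|].
  exists (c * exp (m ^ 2 / (2 * l))). intros x. unfold gauss_base.
  rewrite <- !Rmult_assoc, <- pow_add, !Rabs_mult, (Rabs_pos_eq (exp _)) by (left; apply exp_pos).
  assert (Rabs (cos (y * x + z)) <= 1) by (apply Rabs_le, COS_bound).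
  assert (Rabs (x ^ (j + k)) <= (1 + x ^ 2) ^ (j + k)).
  { rewrite <- RPow_abs. apply pow_incr. split; [apply Rabs_pos|]. apply Rabs_le; nra. }
  assert (exp (- l * x ^ 2 + m * x) <= exp (m ^ 2 / (2 * l)) * exp (- (l / 2 * x ^ 2))).
  { rewrite <- exp_plus. 
    assert (- l * x ^ 2 + m * x <= m ^ 2 / (2 * l) + - (l / 2 * x ^ 2)) as [L|L].
    { apply Rminus_le_0.
      replace (m ^ 2 / (2 * l) + - (l / 2 * x ^ 2) - (- l * x ^ 2 + m * x))
        with ((l / 2) * (x - m / l) ^ 2) by (field; lra).
      apply Rmult_le_pos; [lra|apply pow2_ge_0]. }
    - left. now apply exp_increasing.
    - right. now rewrite L. }
  specialize (Hc x).
  pose proof (exp_pos (- l * x ^ 2 + m * x)). pose proof (exp_pos (m ^ 2 / (2 * l))).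
  pose proof (exp_pos (- (l / 2 * x ^ 2))).
  pose proof (Rabs_pos (x ^ (j + k))).
  apply Rle_trans with (Rabs (x ^ (j + k)) * exp (- l * x ^ 2 + m * x)).
  { apply Rle_trans with (Rabs (x ^ (j + k)) * exp (- l * x ^ 2 + m * x) * 1); [|lra].
    apply Rmult_le_compat_l; [nra|easy]. }
  apply Rle_trans with ((c * exp (l / 2 * x ^ 2)) * (exp (m ^ 2 / (2 * l)) * exp (- (l / 2 * x ^ 2)))).
  { apply Rmult_le_compat; lra. }
  right. replace (c * exp (l / 2 * x ^ 2) * (exp (m ^ 2 / (2 * l)) * exp (- (l / 2 * x ^ 2)))) with
    (c * exp (m ^ 2 / (2 * l)) * (exp (l / 2 * x ^ 2) * exp (- (l / 2 * x ^ 2)))) by ring.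
  rewrite <- exp_plus, Rplus_opp_r, exp_0. ring.
Qed.

Lemma gauss_poly_rapid l m y f : 0 < l -> gauss_poly l m y f -> rapid f.
Proof.
  intros Hl. induction 1 as [k z|f g _ IHf _ IHg|c f _ IH].
  - now apply gauss_base_rapid.
  - now apply rapid_plus.
  - intros k. destruct (IH k) as [M HM]. exists (Rabs c * M). intros x.
    replace (x ^ k * (c * f x)) with (c * (x ^ k * f x)) by ring.
    rewrite Rabs_mult. apply Rmult_le_compat_l; [apply Rabs_pos|apply HM].
Qed.

Lemma gauss_poly_schwartz l m y f : 0 < l -> gauss_poly l m y f -> schwartz f.
Proof.
  intros Hl H. split.
  - intros n x. destruct (gauss_poly_is_derive _ _ _ _ (gauss_poly_Derive_n l m y f n H)) as [g [_ D]].
    exists (g x). apply D.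
  - intros k n. apply (gauss_poly_rapid l m y); [easy|now apply gauss_poly_Derive_n].
Qed.

Lemma gauss_poly_dom l m y f : 0 < l -> gauss_poly l m y f -> dom f.
Proof.
  intros Hl H. apply rapid_dom.
  - intros x. now apply gauss_poly_continuous with l m y.
  - now apply gauss_poly_rapid with l m y.
Qed.

Lemma schwartz_rapid phi n : schwartz phi -> rapid (Derive_n phi n).
Proof. intros H k. apply H. Qed.

Lemma schwartz_continuous phi n x : schwartz phi -> continuous (Derive_n phi n) x.
Proof. intros H. apply (ex_derive_continuous (Derive_n phi n)). apply H. Qed.

Lemma dom_schwartz_mult phi n g : schwartz phi -> (forall x, continuous g x) -> pgrow g ->
  dom (fun x => Derive_n phi n x * g x).
Proof.
  intros Hp Cg Hg. apply rapid_dom.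
  - intros x. apply (continuous_mult (Derive_n phi n) g); [now apply schwartz_continuous|auto].
  - apply rapid_mult_pgrow; [now apply schwartz_rapid|easy].
Qed.

(** * Gaussian kernels *)

Lemma cont2_const c : cont2 (fun _ _ => c).
Proof. intros z. apply continuous_const. Qed.

Lemma cont2_fst h : (forall x, continuous h x) -> cont2 (fun s _ => h s).
Proof. intros H z. apply (continuous_comp fst h); [apply continuous_fst|apply H]. Qed.

Lemma cont2_snd h : (forall x, continuous h x) -> cont2 (fun _ t => h t).
Proof. intros H z. apply (continuous_comp snd h); [apply continuous_snd|apply H]. Qed.

Lemma cont2_plus f g : cont2 f -> cont2 g -> cont2 (fun s t => f s t + g s t).
Proof. intros Hf Hg z. apply (continuous_plus (fun z => f (fst z) (snd z)) (fun z => g (fst z) (snd z)) z); auto. Qed.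

Lemma cont2_minus f g : cont2 f -> cont2 g -> cont2 (fun s t => f s t - g s t).
Proof. intros Hf Hg z. apply (continuous_minus (fun z => f (fst z) (snd z)) (fun z => g (fst z) (snd z)) z); auto. Qed.

Lemma cont2_mult f g : cont2 f -> cont2 g -> cont2 (fun s t => f s t * g s t).
Proof. intros Hf Hg z. apply (continuous_mult (fun z => f (fst z) (snd z)) (fun z => g (fst z) (snd z)) z); auto. Qed.

Lemma cont2_comp1 h f : (forall x, continuous h x) -> cont2 f -> cont2 (fun s t => h (f s t)).
Proof. intros Hh Hf z. apply (continuous_comp (fun z => f (fst z) (snd z)) h z); auto. Qed.

Lemma continuous_pow n x : continuous (fun y : R => y ^ n) x.
Proof. apply (ex_derive_continuous (fun y : R => y ^ n)). auto_derive. auto. Qed.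

Ltac cont2_tac := repeat match goal with
  | |- cont2 (fun _ _ => ?c) => apply (cont2_const c)
  | |- cont2 (fun s _ => s) => apply (cont2_fst (fun s => s)); intros; apply continuous_id
  | |- cont2 (fun _ t => t) => apply (cont2_snd (fun t => t)); intros; apply continuous_id
  | |- cont2 (fun s t => @?f s t - @?g s t) => apply (cont2_minus f g)
  | |- cont2 (fun s t => @?f s t + @?g s t) => apply (cont2_plus f g)
  | |- cont2 (fun s t => @?f s t * @?g s t) => apply (cont2_mult f g)
  | |- cont2 (fun s t => @?f s t ^ ?n) => apply (cont2_comp1 (fun u => u ^ n) f (continuous_pow n))
  | |- cont2 (fun s t => exp (@?f s t)) => apply (cont2_comp1 exp f continuous_exp)
  | |- cont2 (fun s t => sin (@?f s t)) => apply (cont2_comp1 sin f continuous_sin)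
  | |- cont2 (fun _ t => ?h t) => apply (cont2_snd h); assumption
  end.

Lemma dom_bounded_mult F g B : (forall x, continuous F x) -> (forall x, Rabs (F x) <= B) ->
  dom g -> dom (fun x => F x * g x).
Proof.
  intros CF BF [Cg [C Dg]]. split.
  - intros x. apply (continuous_mult F g x); auto.
  - exists (B * C). intros x. rewrite Rabs_mult. unfold Rdiv. rewrite Rmult_assoc.
    apply Rmult_le_compat; auto using Rabs_pos.
Qed.

Definition gauss (m x t : R) : R := exp (- m * (t - x) ^ 2).

Lemma gauss_poly_ext l m y f g : (forall x, f x = g x) -> gauss_poly l m y f -> gauss_poly l m y g.
Proof. intros E. now rewrite (functional_extensionality f g E). Qed.

Lemma gauss_base_zero m x k t :
  gauss_base m (2 * m * x) 0 k 0 t = exp (m * x ^ 2) * (t ^ k * gauss m x t).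
Proof.
  unfold gauss_base, gauss. rewrite Rmult_0_l, Rplus_0_r, cos_0, Rmult_1_r.
  replace (- m * t ^ 2 + 2 * m * x * t) with (m * x ^ 2 + - m * (t - x) ^ 2) by ring.
  rewrite exp_plus. ring.
Qed.

Lemma gauss_poly_moment m x k : gauss_poly m (2 * m * x) 0 (fun t => t ^ k * gauss m x t).
Proof.
  apply gauss_poly_ext with (fun t => exp (- (m * x ^ 2)) * gauss_base m (2 * m * x) 0 k 0 t).
  - intros t. rewrite gauss_base_zero, <- Rmult_assoc, <- exp_plus, Rplus_opp_l, exp_0. ring.
  - apply gp_scal, gp_base.
Qed.

Lemma gauss_poly_gauss m x : gauss_poly m (2 * m * x) 0 (gauss m x).
Proof.
  apply gauss_poly_ext with (fun t => t ^ 0 * gauss m x t); [intros; simpl; ring|].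
  apply gauss_poly_moment.
Qed.

Lemma gauss_poly_central1 m x : gauss_poly m (2 * m * x) 0 (fun t => (t - x) * gauss m x t).
Proof.
  apply gauss_poly_ext with (fun t => t ^ 1 * gauss m x t + (- x) * gauss m x t).
  { intros; simpl; ring. }
  apply gp_plus; [apply gauss_poly_moment|apply gp_scal, gauss_poly_gauss].
Qed.

Lemma gauss_poly_central2 m x : gauss_poly m (2 * m * x) 0 (fun t => (t - x) ^ 2 * gauss m x t).
Proof.
  apply gauss_poly_ext with
    (fun t => t ^ 2 * gauss m x t + ((- 2 * x) * (t ^ 1 * gauss m x t) + x ^ 2 * gauss m x t)).
  { intros; simpl; ring. }
  repeat (apply gp_plus || apply gp_scal || apply gauss_poly_moment || apply gauss_poly_gauss).
Qed.

Lemma is_derive_gauss m x t : is_derive (gauss m x) t (- (2 * m) * ((t - x) * gauss m x t)).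
Proof. unfold gauss. auto_derive; [auto|]. unfold Rminus; simpl; ring. Qed.

Lemma int_gauss_central1 m x : 0 < m -> int (fun t => (t - x) * gauss m x t) = 0.
Proof.
  intros Hm.
  assert (K : int (fun t => - (2 * m) * ((t - x) * gauss m x t)) = 0).
  { apply (int_derive_zero (gauss m x)).
    - apply (gauss_poly_dom m (2 * m * x) 0); [easy|apply gauss_poly_gauss].
    - apply is_derive_gauss.
    - intros t. apply gauss_poly_continuous with m (2 * m * x) 0. apply gp_scal, gauss_poly_central1. }
  rewrite int_scal in K by (apply (gauss_poly_dom m (2 * m * x) 0); [easy|apply gauss_poly_central1]).
  nra.
Qed.

(** The derivative of [(t - x) * gauss m x t] integrates to zero. The resulting variance 1/(2m)
    measures how the kernel concentrates at x as m grows. *)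
Lemma int_gauss_central2 m x : 0 < m ->
  int (fun t => (t - x) ^ 2 * gauss m x t) = int (gauss m x) / (2 * m).
Proof.
  intros Hm.
  assert (D0 : dom (gauss m x)) by (apply (gauss_poly_dom m (2 * m * x) 0); [easy|apply gauss_poly_gauss]).
  assert (D2 : dom (fun t => (t - x) ^ 2 * gauss m x t))
    by (apply (gauss_poly_dom m (2 * m * x) 0); [easy|apply gauss_poly_central2]).
  assert (K : int (fun t => gauss m x t + - (2 * m) * ((t - x) ^ 2 * gauss m x t)) = 0).
  { apply (int_derive_zero (fun t => (t - x) * gauss m x t)).
    - apply (gauss_poly_dom m (2 * m * x) 0); [easy|apply gauss_poly_central1].
    - intros t. unfold gauss. auto_derive; [auto|]. unfold Rminus; simpl; ring.
    - intros t. apply gauss_poly_continuous with m (2 * m * x) 0.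
      apply gp_plus; [apply gauss_poly_gauss|apply gp_scal, gauss_poly_central2]. }
  rewrite int_plus, int_scal in K by (try apply dom_scal; easy).
  apply Rmult_eq_reg_l with (2 * m); [|lra].
  replace (2 * m * (int (gauss m x) / (2 * m))) with (int (gauss m x)) by (field; lra). lra.
Qed.

Lemma gauss_central1_loc_dom m F B : 0 < m -> (forall t, Rabs (F t) <= B) ->
  loc_dom (fun x t => F t * ((t - x) * gauss m x t)).
Proof.
  intros Hm BF r.
  destruct (rapid_weight 1 (fun t => (t - 0) * gauss m 0 t)
    (gauss_poly_rapid _ _ _ _ Hm (gauss_poly_central1 m 0)) 0%nat) as [M HM].
  exists (B * (M * (2 * (1 + r ^ 2)))). intros x Hx t.
  specialize (HM (t - x)).
  rewrite pow_O, Rmult_1_l, pow_1 in HM. unfold gauss in *. rewrite !Rminus_0_r in HM.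
  rewrite Rabs_mult, (Rabs_pos_eq (1 + _)) in HM by (pose proof (pow2_ge_0 (t - x)); lra).
  set (u := (t - x) * exp (- m * (t - x) ^ 2)) in *.
  rewrite Rabs_mult. unfold Rdiv. rewrite Rmult_assoc.
  apply Rmult_le_compat; [apply Rabs_pos|apply Rabs_pos|apply BF|].
  apply Rmult_le_reg_r with (1 + t ^ 2); [nra|].
  rewrite Rmult_assoc, Rinv_l, Rmult_1_r by nra.
  assert (x ^ 2 <= r ^ 2).
  { rewrite <- (pow2_abs x). apply pow_incr. split; [apply Rabs_pos|easy]. }
  (* Peetre's inequality moves the centre of the weight from x to 0; its core t^2 <= 2(t-x)^2 + 2x^2
     is the square (t-2x)^2 >= 0. *)
  assert (1 + t ^ 2 <= (1 + (t - x) ^ 2) * (2 * (1 + r ^ 2))).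
  { pose proof (pow2_ge_0 (t - 2 * x)). pose proof (pow2_ge_0 (t - x)). pose proof (pow2_ge_0 r).
    assert (0 <= (t - x) ^ 2 * r ^ 2) by now apply Rmult_le_pos. nra. }
  pose proof (Rabs_pos u). pose proof (pow2_ge_0 r).
  apply Rle_trans with (Rabs u * ((1 + (t - x) ^ 2) * (2 * (1 + r ^ 2)))).
  - now apply Rmult_le_compat_l.
  - rewrite <- Rmult_assoc. apply Rmult_le_compat_r; [lra|]. lra.
Qed.

(* d/dx gauss m x t = 2 m (t - x) gauss m x t, so the hypothesis says that the convolution of F
   with the Gaussian has zero derivative. *)
Lemma gauss_convolution_const m F B a b : 0 < m ->
  (forall t, continuous F t) -> (forall t, Rabs (F t) <= B) ->
  (forall x, int (fun t => F t * ((t - x) * gauss m x t)) = 0) ->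
  int (fun t => F t * gauss m b t) = int (fun t => F t * gauss m a t).
Proof.
  intros Hm CF BF H.
  assert (D : forall x, dom (fun t => F t * gauss m x t)).
  { intros x. apply dom_bounded_mult with B; try easy.
    apply (gauss_poly_dom m (2 * m * x) 0); [easy|apply gauss_poly_gauss]. }
  assert (C2 : cont2 (fun x t => F t * ((t - x) * gauss m x t))).
  { unfold gauss. cont2_tac. }
  pose proof (RInt_int_swap (fun x t => F t * ((t - x) * gauss m x t)) a b C2
    (gauss_central1_loc_dom m F B Hm BF)) as S.
  rewrite (RInt_ext _ (fun _ => 0)) in S by (intros; apply H).
  rewrite RInt_const in S. unfold scal in S; simpl in S. unfold mult in S; simpl in S.
  rewrite Rmult_0_r in S.
  rewrite (int_ext _ (fun t => / (2 * m) * (F t * gauss m b t - F t * gauss m a t))) in S.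
  - rewrite int_scal, int_minus in S by (try apply dom_minus; easy).
    assert (0 < / (2 * m)) by (apply Rinv_0_lt_compat; lra).
    assert (int (fun t => F t * gauss m b t) - int (fun t => F t * gauss m a t) = 0); [|lra].
    apply Rmult_eq_reg_l with (/ (2 * m)); [|lra]. rewrite Rmult_0_r. symmetry. apply S.
  - intros t. apply is_RInt_unique.
    replace (/ (2 * m) * (F t * gauss m b t - F t * gauss m a t)) with
      (minus (/ (2 * m) * (F t * gauss m b t)) (/ (2 * m) * (F t * gauss m a t)))
      by (unfold minus, plus, opp; simpl; ring).
    apply (is_RInt_derive (fun x => / (2 * m) * (F t * gauss m x t))).
    + intros x _. unfold gauss. auto_derive; [auto|]. unfold Rminus; simpl; field. lra.
    + intros x _. apply (ex_derive_continuous (fun x => F t * ((t - x) * gauss m x t))).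
      unfold gauss. auto_derive. auto.
Qed.

(** A quantitative approximate identity: a quadratic majorant eps + C(t-b)^2 of |F(t) - F(b)| is
    integrated by the second moment. The constant C is fixed before m, so m can be taken large
    afterwards. The total mass stays as a factor on both sides. *)
Lemma gauss_convolution_close F B b eps : (forall t, continuous F t) ->
  (forall t, Rabs (F t) <= B) -> 0 < eps ->
  exists C, 0 <= C /\ forall m, 0 < m ->
    Rabs (int (fun t => F t * gauss m b t) - F b * int (gauss m b))
      <= (eps + C / (2 * m)) * int (gauss m b).
Proof.
  intros CF BF He.
  destruct (continuous_eps_inv F b (CF b) eps He) as [d [Hd K]].
  assert (HB : 0 <= B) by (pose proof (BF 0); pose proof (Rabs_pos (F 0)); lra).
  (* Within distance d continuity gives eps; beyond it C(t-b)^2 >= C d^2 = 2B, which exceeds any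
     variation of F. *)
  set (C := 2 * B / d ^ 2).
  assert (HC : 0 <= C) by (apply Rdiv_le_0_compat; [lra|apply pow_lt; lra]).
  assert (P : forall t, Rabs (F t - F b) <= eps + C * (t - b) ^ 2).
  { intros t. pose proof (pow2_ge_0 (t - b)).
    destruct (Rlt_dec (Rabs (t - b)) d) as [L|L].
    - specialize (K t L). nra.
    - assert (d ^ 2 <= (t - b) ^ 2).
      { rewrite <- (pow2_abs (t - b)). apply pow_incr. lra. }
      assert (Rabs (F t - F b) <= 2 * B).
      { eapply Rle_trans; [apply Rabs_triang|]. rewrite Rabs_Ropp.
        pose proof (BF t). pose proof (BF b). lra. }
      assert (C * d ^ 2 = 2 * B) by (unfold C; field; lra). nra. }
  exists C. split; [easy|]. intros m Hm.
  assert (D0 : dom (gauss m b)) by (apply (gauss_poly_dom m (2 * m * b) 0); [easy|apply gauss_poly_gauss]).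
  assert (D2 : dom (fun t => (t - b) ^ 2 * gauss m b t))
    by (apply (gauss_poly_dom m (2 * m * b) 0); [easy|apply gauss_poly_central2]).
  assert (DF : dom (fun t => F t * gauss m b t)) by (apply dom_bounded_mult with B; easy).
  rewrite <- int_scal, <- int_minus by (try apply dom_scal; easy).
  replace ((eps + C / (2 * m)) * int (gauss m b)) with
    (eps * int (gauss m b) + C * (int (gauss m b) / (2 * m))) by (field; lra).
  rewrite <- int_gauss_central2, <- !int_scal, <- int_plus by (try apply dom_scal; easy).
  apply int_abs_le.
  - apply dom_minus; [easy|now apply dom_scal].
  - apply dom_plus; now apply dom_scal.
  - intros t. rewrite <- Rmult_minus_distr_r, Rabs_mult.
    assert (0 < gauss m b t) by apply exp_pos.
    rewrite (Rabs_pos_eq (gauss m b t)) by lra. specialize (P t). nra.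
Qed.

(** The convolutions at a and b coincide, yet approximate F(a) and F(b) times one common mass. A gap
    D = |F(b) - F(a)| > 0 contradicts this: each approximation contributes at most D/4 plus a term
    of order 1/m. *)
Lemma gauss_derivative_orthogonal_const F B : (forall t, continuous F t) ->
  (forall t, Rabs (F t) <= B) ->
  (forall m x, 0 < m -> int (fun t => F t * ((t - x) * gauss m x t)) = 0) ->
  forall a b, F a = F b.
Proof.
  intros CF BF H a b.
  destruct (Req_dec (F b - F a) 0) as [E|E]; [lra|exfalso].
  set (D := Rabs (F b - F a)).
  assert (HD : 0 < D) by now apply Rabs_pos_lt.
  destruct (gauss_convolution_close F B a (D / 4) CF BF) as [Ca [PCa Ha]]; [lra|].
  destruct (gauss_convolution_close F B b (D / 4) CF BF) as [Cb [PCb Hb]]; [lra|].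
  (* This makes Ca + Cb < D m, so the two variance terms add up to less than D/2. *)
  set (m := (Ca + Cb) / D + 1).
  assert (Hm : 0 < m).
  { assert (0 <= (Ca + Cb) / D) by (apply Rdiv_le_0_compat; lra). unfold m; lra. }
  assert (Em : D * m = Ca + Cb + D) by (unfold m; field; lra).
  specialize (Ha m Hm). specialize (Hb m Hm).
  (* The mass is translation invariant: it is the convolution of the Gaussian with the constant 1,
     to which the same constancy lemma applies. *)
  assert (E1 : int (gauss m b) = int (gauss m a)).
  { rewrite (int_ext (gauss m b) (fun t => 1 * gauss m b t)) by (intros; ring).
    rewrite (int_ext (gauss m a) (fun t => 1 * gauss m a t)) by (intros; ring).
    apply (gauss_convolution_const m (fun _ => 1) 1); try easy.
    - intros; apply continuous_const.
    - intros; rewrite Rabs_R1; lra.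
    - intros x. rewrite (int_ext _ (fun t => (t - x) * gauss m x t)) by (intros; ring).
      now apply int_gauss_central1. }
  rewrite (gauss_convolution_const m F B a b Hm CF BF (fun x => H m x Hm)), E1 in Hb.
  set (I := int (gauss m a)) in *.
  assert (PI' : 0 < I).
  { apply int_pos; [|intros; apply exp_pos].
    apply (gauss_poly_dom m (2 * m * a) 0); [easy|apply gauss_poly_gauss]. }
  assert (D * I <= (D / 2 + (Ca + Cb) / (2 * m)) * I).
  { unfold D. rewrite <- (Rabs_pos_eq I) at 1 by lra. rewrite <- Rabs_mult.
    set (J := int (fun t => F t * gauss m a t)) in *.
    replace ((F b - F a) * I) with ((J - F a * I) - (J - F b * I)) by ring.
    eapply Rle_trans; [apply Rabs_triang|]. rewrite Rabs_Ropp. fold D.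
    replace ((D / 2 + (Ca + Cb) / (2 * m)) * I) with
      ((D / 4 + Ca / (2 * m)) * I + (D / 4 + Cb / (2 * m)) * I) by (field; lra). lra. }
  apply Rmult_le_reg_r in H0; [|easy].
  assert (K : (Ca + Cb) / (2 * m) * (2 * m) = Ca + Cb) by (field; lra). nra.
Qed.

(** * The sine transform of [s * exp (- l * s ^ 2)] *)

Definition gauss_sin (l y s : R) : R := s * exp (- l * s ^ 2) * sin (y * s).

Lemma gauss_poly_sin l y : gauss_poly l 0 y (fun s => exp (- l * s ^ 2) * sin (y * s)).
Proof.
  apply gauss_poly_ext with (gauss_base l 0 y 0 (- (PI / 2))); [|apply gp_base].
  intros s. unfold gauss_base. rewrite Rmult_0_l, Rplus_0_r, cos_plus, cos_neg, sin_neg, cos_PI2, sin_PI2.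
  simpl. ring.
Qed.

Lemma gauss_poly_cos l y : gauss_poly l 0 y (fun s => exp (- l * s ^ 2) * cos (y * s)).
Proof.
  apply gauss_poly_ext with (gauss_base l 0 y 0 0); [|apply gp_base].
  intros s. unfold gauss_base. rewrite Rmult_0_l, !Rplus_0_r. simpl. ring.
Qed.

Lemma gauss_poly_gauss_sin l y : gauss_poly l 0 y (gauss_sin l y).
Proof.
  apply gauss_poly_ext with (gauss_base l 0 y 1 (- (PI / 2))); [|apply gp_base].
  intros s. unfold gauss_base, gauss_sin.
  rewrite Rmult_0_l, Rplus_0_r, cos_plus, cos_neg, sin_neg, cos_PI2, sin_PI2. simpl. ring.
Qed.

(* The cosine transform g of the Gaussian satisfies g' = - h and h = (y / 2l) g, h being the
   integral below. *)
Lemma int_gauss_sin l : 0 < l -> exists c, 0 < c /\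
  forall y, int (gauss_sin l y) = c * (y * exp (- / (4 * l) * y ^ 2)).
Proof.
  intros Hl.
  set (g := fun y => int (fun s => exp (- l * s ^ 2) * cos (y * s))).
  set (h := fun y => int (gauss_sin l y)).
  assert (Dc : forall y, dom (fun s => exp (- l * s ^ 2) * cos (y * s)))
    by (intros y; apply (gauss_poly_dom l 0 y); [easy|apply gauss_poly_cos]).
  assert (Ds : forall y, dom (gauss_sin l y))
    by (intros y; apply (gauss_poly_dom l 0 y); [easy|apply gauss_poly_gauss_sin]).
  assert (Hhg : forall y, h y = y / (2 * l) * g y).
  { intros y.
    assert (K : int (fun s => - (2 * l) * gauss_sin l y s + y * (exp (- l * s ^ 2) * cos (y * s))) = 0).
    { apply (int_derive_zero (fun s => exp (- l * s ^ 2) * sin (y * s))).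
      - apply (gauss_poly_dom l 0 y); [easy|apply gauss_poly_sin].
      - intros s. unfold gauss_sin. auto_derive; [auto|]. simpl; ring.
      - intros s. apply gauss_poly_continuous with l 0 y.
        apply gp_plus; apply gp_scal; [apply gauss_poly_gauss_sin|apply gauss_poly_cos]. }
    rewrite int_plus, !int_scal in K by (try apply dom_scal; easy).
    fold (g y) in K. fold (h y) in K.
    apply Rmult_eq_reg_l with (2 * l); [|lra].
    replace (2 * l * (y / (2 * l) * g y)) with (y * g y) by (field; lra). lra. }
  assert (C2 : cont2 (gauss_sin l)) by (unfold gauss_sin; cont2_tac).
  assert (LD : loc_dom (gauss_sin l)).
  { intros r.
    destruct (gauss_poly_dom l (2 * l * 0) 0 _ Hl (gauss_poly_moment l 0 1)) as [_ [C DC]].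
    exists C. intros y _ s. eapply Rle_trans; [|apply DC].
    unfold gauss_sin, gauss. rewrite Rminus_0_r, pow_1, (Rabs_mult (_ * _)).
    assert (Rabs (sin (y * s)) <= 1) by apply Rabs_le, SIN_bound.
    pose proof (Rabs_pos (s * exp (- l * s ^ 2))). nra. }
  assert (Hg : forall y, g y = g 0 - RInt h 0 y).
  { intros y. unfold h. rewrite (RInt_int_swap (gauss_sin l) 0 y C2 LD).
    rewrite (int_ext _ (fun s => exp (- l * s ^ 2) * cos (0 * s) - exp (- l * s ^ 2) * cos (y * s))).
    - rewrite int_minus by easy. fold (g 0) (g y). ring.
    - intros s. apply is_RInt_unique.
      replace (exp (- l * s ^ 2) * cos (0 * s) - exp (- l * s ^ 2) * cos (y * s)) with
        (minus (- (exp (- l * s ^ 2) * cos (y * s))) (- (exp (- l * s ^ 2) * cos (0 * s))))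
        by (unfold minus, plus, opp; simpl; ring).
      apply (is_RInt_derive (fun y => - (exp (- l * s ^ 2) * cos (y * s)))).
      + intros x _. unfold gauss_sin. auto_derive; [auto|]. simpl; ring.
      + intros x _. now apply (cont2_l (gauss_sin l)). }
  assert (Dg : forall y, is_derive g y (- (y / (2 * l) * g y))).
  { intros y. rewrite <- Hhg.
    apply is_derive_ext with (fun y => g 0 - RInt h 0 y); [intros; symmetry; apply Hg|].
    replace (- h y) with (minus 0 (h y)) by (unfold minus, plus, opp; simpl; ring).
    apply (is_derive_minus (fun _ => g 0) (RInt h 0)); [apply @is_derive_const|].
    apply is_derive_primitive. intros x. now apply continuous_int_param. }
  assert (Eg : forall y, g y = g 0 * exp (- / (4 * l) * y ^ 2)).
  { intros y.
    assert (K : g y * exp (/ (4 * l) * y ^ 2) = g 0 * exp (/ (4 * l) * 0 ^ 2)).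
    { apply (derive_zero_const (fun y => g y * exp (/ (4 * l) * y ^ 2))). intros x.
      replace 0 with (plus (mult (- (x / (2 * l) * g x)) (exp (/ (4 * l) * x ^ 2)))
        (mult (g x) (x / (2 * l) * exp (/ (4 * l) * x ^ 2))))
        by (unfold plus, mult; simpl; ring).
      apply (is_derive_mult g (fun y => exp (/ (4 * l) * y ^ 2))).
      - apply Dg.
      - auto_derive; [auto|]. simpl; field. lra.
      - intros; apply Rmult_comm. }
    replace (/ (4 * l) * 0 ^ 2) with 0 in K by (simpl; ring). rewrite exp_0, Rmult_1_r in K.
    rewrite <- K, Rmult_assoc, <- exp_plus.
    replace (/ (4 * l) * y ^ 2 + - / (4 * l) * y ^ 2) with 0 by ring.
    rewrite exp_0. ring. }
  exists (/ (2 * l) * g 0). split.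
  - apply Rmult_lt_0_compat; [apply Rinv_0_lt_compat; lra|].
    apply int_pos; [easy|]. intros s. rewrite Rmult_0_l, cos_0, Rmult_1_r. apply exp_pos.
  - intros y. change (h y = / (2 * l) * g 0 * (y * exp (- / (4 * l) * y ^ 2))).
    rewrite Hhg, Eg. unfold Rdiv. ring.
Qed.

(** * The kernel d/dt v_s(t) *)

Lemma nonneg_of_derive (f f' : R -> R) : (forall x, is_derive f x (f' x)) ->
  (forall x, 0 <= x -> 0 <= f' x) -> 0 <= f 0 -> forall x, 0 <= x -> 0 <= f x.
Proof.
  intros D P H x Hx.
  destruct (MVT_gen f 0 x f') as [c [Hc E]].
  - intros; apply D.
  - intros y _. apply continuity_pt_filterlim. apply (ex_derive_continuous f). exists (f' y). apply D.
  - rewrite Rmin_left, Rmax_right in Hc by easy. specialize (P c (proj1 Hc)). nra.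
Qed.

(** Each auxiliary function is nonnegative at 0 and has the preceding one as derivative. The chain
    [A1] to [A4] starts from 1 - cos u >= 0 and yields the usual alternating bounds. The chain [B1]
    to [B4] starts from 1 - sin u >= 0 and yields majorants of the other parity, cubic for the
    cosine and quartic for the sine. *)
Lemma sin_cos_taylor_nonneg u : 0 <= u ->
  0 <= 1 - cos u <= u ^ 2 / 2 /\
  0 <= u - sin u <= u ^ 3 / 6 /\
  0 <= cos u - 1 + u ^ 2 / 2 <= u ^ 3 / 6 /\
  cos u - 1 + u ^ 2 / 2 <= u ^ 4 / 24 /\
  0 <= sin u - u + u ^ 3 / 6 <= u ^ 4 / 24.
Proof.
  assert (A1 : forall u, 0 <= u -> 0 <= u - sin u).
  { apply (nonneg_of_derive (fun u => u - sin u) (fun u => 1 - cos u)).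
    - intros x. auto_derive; [auto|]. ring.
    - intros x _. pose proof (COS_bound x). lra.
    - rewrite sin_0. lra. }
  assert (A2 : forall u, 0 <= u -> 0 <= cos u - 1 + u ^ 2 / 2).
  { apply (nonneg_of_derive (fun u => cos u - 1 + u ^ 2 / 2) (fun u => u - sin u)); [|easy|].
    - intros x. auto_derive; [auto|]. field.
    - rewrite cos_0. lra. }
  assert (A3 : forall u, 0 <= u -> 0 <= sin u - u + u ^ 3 / 6).
  { apply (nonneg_of_derive (fun u => sin u - u + u ^ 3 / 6) (fun u => cos u - 1 + u ^ 2 / 2)); [|easy|].
    - intros x. auto_derive; [auto|]. field.
    - rewrite sin_0. lra. }
  assert (A4 : forall u, 0 <= u -> 0 <= u ^ 4 / 24 - (cos u - 1 + u ^ 2 / 2)).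
  { apply (nonneg_of_derive (fun u => u ^ 4 / 24 - (cos u - 1 + u ^ 2 / 2)) (fun u => sin u - u + u ^ 3 / 6)); [|easy|].
    - intros x. auto_derive; [auto|]. field.
    - rewrite cos_0. lra. }
  assert (B1 : forall u, 0 <= u -> 0 <= u - 1 + cos u).
  { apply (nonneg_of_derive (fun u => u - 1 + cos u) (fun u => 1 - sin u)).
    - intros x. auto_derive; [auto|]. ring.
    - intros x _. pose proof (SIN_bound x). lra.
    - rewrite cos_0. lra. }
  assert (B2 : forall u, 0 <= u -> 0 <= u ^ 2 / 2 - u + sin u).
  { apply (nonneg_of_derive (fun u => u ^ 2 / 2 - u + sin u) (fun u => u - 1 + cos u)); [|easy|].
    - intros x. auto_derive; [auto|]. field.
    - rewrite sin_0. lra. }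
  assert (B3 : forall u, 0 <= u -> 0 <= u ^ 3 / 6 - (cos u - 1 + u ^ 2 / 2)).
  { apply (nonneg_of_derive (fun u => u ^ 3 / 6 - (cos u - 1 + u ^ 2 / 2)) (fun u => u ^ 2 / 2 - u + sin u)); [|easy|].
    - intros x. auto_derive; [auto|]. field.
    - rewrite cos_0. lra. }
  assert (B4 : forall u, 0 <= u -> 0 <= u ^ 4 / 24 - (sin u - u + u ^ 3 / 6)).
  { apply (nonneg_of_derive (fun u => u ^ 4 / 24 - (sin u - u + u ^ 3 / 6)) (fun u => u ^ 3 / 6 - (cos u - 1 + u ^ 2 / 2))); [|easy|].
    - intros x. auto_derive; [auto|]. field.
    - rewrite sin_0. lra. }
  intros Hu. specialize (A1 u Hu). specialize (A2 u Hu). specialize (A3 u Hu).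
  specialize (A4 u Hu). specialize (B3 u Hu). specialize (B4 u Hu).
  pose proof (COS_bound u). repeat split; lra.
Qed.

Lemma sin_cos_taylor u :
  Rabs (1 - cos u) <= u ^ 2 / 2 /\
  Rabs (sin u - u) <= Rabs u ^ 3 / 6 /\
  Rabs (cos u - 1 + u ^ 2 / 2) <= Rabs u ^ 3 / 6 /\
  Rabs (cos u - 1 + u ^ 2 / 2) <= u ^ 4 / 24 /\
  Rabs (sin u - u + u ^ 3 / 6) <= u ^ 4 / 24.
Proof.
  destruct (Rle_dec 0 u) as [H|H].
  - pose proof (sin_cos_taylor_nonneg u H). rewrite (Rabs_pos_eq u H).
    repeat split; apply Rabs_le; lra.
  - assert (H' : 0 <= - u) by lra. pose proof (sin_cos_taylor_nonneg (- u) H') as K.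
    rewrite sin_neg, cos_neg in K. rewrite (Rabs_left1 u) by lra.
    replace ((- u) ^ 3) with (- u ^ 3) in * by ring.
    replace ((- u) ^ 2) with (u ^ 2) in K by ring. replace ((- u) ^ 4) with (u ^ 4) in K by ring.
    repeat split; apply Rabs_le; lra.
Qed.

(* Real and imaginary parts of w', where w(u) = (1 - i u - e^{-iu}) / u^2 is the profile
   with v_s(t) = s^2 w(s t). *)
Definition w're (u : R) : R :=
  if Req_EM_T u 0 then 0 else sin u / u ^ 2 - 2 * (1 - cos u) / u ^ 3.

Definition w'im (u : R) : R :=
  if Req_EM_T u 0 then - / 6 else (cos u - 1) / u ^ 2 - 2 * (sin u - u) / u ^ 3.

Lemma Rabs_div_pow_le a u n B : u <> 0 -> Rabs a <= B * Rabs u ^ n -> Rabs (a / u ^ n) <= B.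
Proof.
  intros Hu H. assert (0 < Rabs u ^ n) by (apply pow_lt; now apply Rabs_pos_lt).
  unfold Rdiv. rewrite Rabs_mult, Rabs_inv, <- RPow_abs.
  apply Rmult_le_reg_r with (Rabs u ^ n); [easy|].
  rewrite Rmult_assoc, Rinv_l, Rmult_1_r by lra. easy.
Qed.

Lemma w're_near_0 u : Rabs (w're u) <= Rabs u / 4.
Proof.
  unfold w're. destruct Req_EM_T as [E|E].
  - rewrite Rabs_R0. pose proof (Rabs_pos u). lra.
  (* The terms u^2 of u sin u and of 2(1 - cos u) cancel, leaving two Taylor remainders of order
     u^4; their constants add to 1/6 + 2/24 = 1/4. *)
  - replace (sin u / u ^ 2 - 2 * (1 - cos u) / u ^ 3) with
      ((u * (sin u - u) + 2 * (cos u - 1 + u ^ 2 / 2)) / u ^ 3) by (field; easy).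
    apply Rabs_div_pow_le; [easy|].
    destruct (sin_cos_taylor u) as [_ [H1 [_ [H2 _]]]].
    eapply Rle_trans; [apply Rabs_triang|]. rewrite !Rabs_mult, (Rabs_pos_eq 2) by lra.
    replace (u ^ 4) with (Rabs u ^ 4) in H2
      by (rewrite RPow_abs; apply Rabs_pos_eq; replace (u ^ 4) with ((u ^ 2) ^ 2) by ring; apply pow2_ge_0).
    pose proof (Rabs_pos u).
    apply Rle_trans with (Rabs u * (Rabs u ^ 3 / 6) + 2 * (Rabs u ^ 4 / 24)); [|right; field].
    apply Rplus_le_compat; [now apply Rmult_le_compat_l|lra].
Qed.

Lemma w'im_near_0 u : Rabs (w'im u + / 6) <= Rabs u / 4.
Proof.
  unfold w'im. destruct Req_EM_T as [E|E].
  - rewrite Rplus_opp_l, Rabs_R0. pose proof (Rabs_pos u). lra.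
  - replace ((cos u - 1) / u ^ 2 - 2 * (sin u - u) / u ^ 3 + / 6) with
      ((u * (cos u - 1 + u ^ 2 / 2) + (- 2) * (sin u - u + u ^ 3 / 6)) / u ^ 3) by (field; easy).
    apply Rabs_div_pow_le; [easy|].
    destruct (sin_cos_taylor u) as [_ [_ [H1 [_ H2]]]].
    eapply Rle_trans; [apply Rabs_triang|]. rewrite !Rabs_mult, (Rabs_left1 (- 2)) by lra.
    replace (u ^ 4) with (Rabs u ^ 4) in H2
      by (rewrite RPow_abs; apply Rabs_pos_eq; replace (u ^ 4) with ((u ^ 2) ^ 2) by ring; apply pow2_ge_0).
    pose proof (Rabs_pos u).
    apply Rle_trans with (Rabs u * (Rabs u ^ 3 / 6) + 2 * (Rabs u ^ 4 / 24)); [|right; field].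
    apply Rplus_le_compat; [now apply Rmult_le_compat_l|lra].
Qed.

Lemma continuous_loc_nonzero (f g : R -> R) x : x <> 0 -> (forall y, y <> 0 -> f y = g y) ->
  continuous f x -> continuous g x.
Proof.
  intros Hx E C. apply (continuous_ext_loc _ f); [|easy].
  exists (mkposreal (Rabs x) (Rabs_pos_lt _ Hx)). intros y Hy.
  change (Rabs (y - x) < Rabs x) in Hy. apply E. intros ->.
  rewrite Rminus_0_l, Rabs_Ropp in Hy. lra.
Qed.

Lemma w're_continuous u : continuous w're u.
Proof.
  destruct (Req_dec u 0) as [->|Hu].
  - apply continuous_eps. intros eps He. exists eps. split; [easy|]. intros y Hy.
    rewrite Rminus_0_r in Hy. unfold w're at 2. destruct Req_EM_T; [|easy].
    rewrite Rminus_0_r. pose proof (w're_near_0 y). pose proof (Rabs_pos y). lra.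
  - apply continuous_loc_nonzero with (fun u => sin u / u ^ 2 - 2 * (1 - cos u) / u ^ 3); [easy| |].
    + intros y Hy. unfold w're. now destruct Req_EM_T.
    + apply (ex_derive_continuous (fun u => sin u / u ^ 2 - 2 * (1 - cos u) / u ^ 3)).
      auto_derive. repeat split; try (apply (pow_nonzero u 2 Hu)); try (apply (pow_nonzero u 3 Hu)).
Qed.

Lemma w'im_continuous u : continuous w'im u.
Proof.
  destruct (Req_dec u 0) as [->|Hu].
  - apply continuous_eps. intros eps He. exists eps. split; [easy|]. intros y Hy.
    rewrite Rminus_0_r in Hy. unfold w'im at 2. destruct Req_EM_T; [|easy].
    unfold Rminus. rewrite Ropp_involutive. pose proof (w'im_near_0 y). pose proof (Rabs_pos y). lra.
  - apply continuous_loc_nonzero with (fun u => (cos u - 1) / u ^ 2 - 2 * (sin u - u) / u ^ 3); [easy| |].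
    + intros y Hy. unfold w'im. now destruct Req_EM_T.
    + apply (ex_derive_continuous (fun u => (cos u - 1) / u ^ 2 - 2 * (sin u - u) / u ^ 3)).
      auto_derive. repeat split; try (apply (pow_nonzero u 2 Hu)); try (apply (pow_nonzero u 3 Hu)).
Qed.

(** Since 1 + u^2 is at most 2 for |u| <= 1 and at most 2u^2 for |u| >= 1, doubling the constant 6
    covers both ranges. *)
Lemma decay_split x u : (Rabs u <= 1 -> Rabs x <= 1) -> (1 <= Rabs u -> Rabs x <= 6 / u ^ 2) ->
  Rabs x <= 12 / (1 + u ^ 2).
Proof.
  intros H1 H2. apply Rmult_le_reg_r with (1 + u ^ 2); [nra|].
  unfold Rdiv. rewrite Rmult_assoc, Rinv_l, Rmult_1_r by nra.
  pose proof (Rabs_pos x). pose proof (Rabs_pos u). rewrite <- (pow2_abs u).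
  destruct (Rle_dec (Rabs u) 1) as [L|L].
  - specialize (H1 L). nra.
  - assert (1 <= Rabs u) as L' by lra. specialize (H2 L').
    rewrite <- (pow2_abs u) in H2.
    assert (E : 6 / Rabs u ^ 2 * Rabs u ^ 2 = 6) by (field; lra).
    assert (1 <= Rabs u ^ 2) by now apply pow_R1_Rle.
    assert (Rabs x * Rabs u ^ 2 <= 6) by (rewrite <- E; apply Rmult_le_compat_r; lra).
    assert (Rabs x * 1 <= Rabs x * Rabs u ^ 2) by (apply Rmult_le_compat_l; lra). lra.
Qed.

Lemma w're_bound u : Rabs (w're u) <= 12 / (1 + u ^ 2).
Proof.
  apply decay_split; intros H.
  - pose proof (w're_near_0 u). lra.
  - unfold w're. destruct Req_EM_T as [->|E]; [rewrite Rabs_R0 in H; lra|].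
    replace (sin u / u ^ 2 - 2 * (1 - cos u) / u ^ 3) with
      ((sin u - 2 * (1 - cos u) / u) / u ^ 2) by (field; easy).
    unfold Rdiv at 1 3. rewrite Rabs_mult, (Rabs_pos_eq (/ u ^ 2))
      by (left; now apply Rinv_0_lt_compat, pow2_gt_0).
    apply Rmult_le_compat_r; [left; now apply Rinv_0_lt_compat, pow2_gt_0|].
    pose proof (SIN_bound u). pose proof (COS_bound u).
    eapply Rle_trans; [apply Rabs_triang|]. rewrite Rabs_Ropp.
    assert (Rabs (sin u) <= 1) by (apply Rabs_le; lra).
    assert (Rabs (2 * (1 - cos u) / u) <= 4); [|lra].
    replace u with (u ^ 1) at 2 by ring. apply Rabs_div_pow_le; [easy|].
    rewrite pow_1, Rabs_pos_eq by lra. lra.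
Qed.

Lemma w'im_bound u : Rabs (w'im u) <= 12 / (1 + u ^ 2).
Proof.
  apply decay_split; intros H.
  - pose proof (w'im_near_0 u) as K. apply Rabs_le_between in K. apply Rabs_le. lra.
  - unfold w'im. destruct Req_EM_T as [->|E]; [rewrite Rabs_R0 in H; lra|].
    (* The linear term of sin u - u contributes 2/u^2, which turns cos u - 1 into cos u + 1. The
       numerator is then bounded by 2 + 4 = 6. *)
    replace ((cos u - 1) / u ^ 2 - 2 * (sin u - u) / u ^ 3) with
      ((cos u + 1 - 2 * sin u / u) / u ^ 2) by (field; easy).
    unfold Rdiv at 1 3. rewrite Rabs_mult, (Rabs_pos_eq (/ u ^ 2))
      by (left; now apply Rinv_0_lt_compat, pow2_gt_0).
    apply Rmult_le_compat_r; [left; now apply Rinv_0_lt_compat, pow2_gt_0|].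
    pose proof (SIN_bound u). pose proof (COS_bound u).
    eapply Rle_trans; [apply Rabs_triang|]. rewrite Rabs_Ropp.
    assert (Rabs (cos u + 1) <= 2) by (apply Rabs_le; lra).
    assert (Rabs (2 * sin u / u) <= 4); [|lra].
    replace u with (u ^ 1) at 2 by ring. apply Rabs_div_pow_le; [easy|].
    rewrite pow_1. assert (Rabs (2 * sin u) <= 2) by (apply Rabs_le; lra). lra.
Qed.

(** The chain rule applied to v_s(t) = s^2 w(st). In this form joint continuity in (s, t) holds
    across t = 0 and the decay of w' can be used directly. *)
Definition dv_re (s t : R) : R := s ^ 3 * w're (s * t).
Definition dv_im (s t : R) : R := s ^ 3 * w'im (s * t).

Lemma dv_re_nonzero s t : t <> 0 -> dv_re s t = s * sin (s * t) / t ^ 2 - 2 * (1 - cos (s * t)) / t ^ 3.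
Proof.
  intros Ht. unfold dv_re, w're. destruct Req_EM_T as [E|E].
  - apply Rmult_integral in E. destruct E as [->|E]; [|easy].
    rewrite !Rmult_0_l, cos_0. field. easy.
  - field. split; [easy|]. intros ->. now rewrite Rmult_0_l in E.
Qed.

Lemma dv_im_nonzero s t : t <> 0 ->
  dv_im s t = (s * cos (s * t) - s) / t ^ 2 - 2 * (sin (s * t) - s * t) / t ^ 3.
Proof.
  intros Ht. unfold dv_im, w'im. destruct Req_EM_T as [E|E].
  - apply Rmult_integral in E. destruct E as [->|E]; [|easy].
    rewrite !Rmult_0_l, sin_0. field. easy.
  - field. split; [easy|]. intros ->. now rewrite Rmult_0_l in E.
Qed.

(** Meant for t = 0, where v_s is defined by cases: a Taylor estimate of the difference quotient
    replaces the rules of differentiation. *)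
Lemma is_derive_sq_close (f : R -> R) x l C :
  (forall y, Rabs (f y - f x - l * (y - x)) <= C * (y - x) ^ 2) -> is_derive f x l.
Proof.
  intros H. split; [apply is_linear_scal_l|].
  intros z Hz. apply (is_filter_lim_locally_unique (V := R_NormedModule)) in Hz. subst z. intros eps.
  assert (He : 0 < eps / (Rabs C + 1)).
  { apply Rdiv_lt_0_compat; [apply cond_pos|]. pose proof (Rabs_pos C). lra. }
  exists (mkposreal _ He). intros y Hy. change (Rabs (y - x) < eps / (Rabs C + 1)) in Hy.
  change (Rabs (f y - f x - (y - x) * l) <= eps * Rabs (y - x)).
  rewrite (Rmult_comm (y - x) l). eapply Rle_trans; [apply H|].
  rewrite <- (pow2_abs (y - x)). pose proof (Rabs_pos (y - x)). pose proof (Rle_abs C).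
  pose proof (Rabs_pos C).
  apply (Rmult_lt_compat_l (Rabs C + 1)) in Hy; [|lra].
  replace ((Rabs C + 1) * (eps / (Rabs C + 1))) with (pos eps) in Hy by (field; lra).
  apply Rle_trans with ((C * Rabs (y - x)) * Rabs (y - x)); [right; ring|].
  apply Rmult_le_compat_r; [easy|]. nra.
Qed.

Lemma is_derive_loc_nonzero (f g : R -> R) x l : x <> 0 -> (forall y, y <> 0 -> f y = g y) ->
  is_derive f x l -> is_derive g x l.
Proof.
  intros Hx E D. apply (is_derive_ext_loc f); [|easy].
  exists (mkposreal (Rabs x) (Rabs_pos_lt _ Hx)). intros y Hy.
  change (Rabs (y - x) < Rabs x) in Hy. apply E. intros ->.
  rewrite Rminus_0_l, Rabs_Ropp in Hy. lra.
Qed.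

Lemma is_derive_v_re s t : is_derive (fun u => fst (v s u)) t (dv_re s t).
Proof.
  destruct (Req_dec t 0) as [->|Ht].
  - unfold dv_re, w're. rewrite Rmult_0_r. destruct Req_EM_T; [|easy].
    (* The fourth-order remainder (sy)^4/24 of the cosine, divided by y^2, gives this constant. *)
    rewrite Rmult_0_r. apply is_derive_sq_close with (s ^ 4 / 24). intros y.
    rewrite Rmult_0_l, !Rminus_0_r. unfold v at 2. destruct Req_EM_T; [|easy].
    unfold v. destruct Req_EM_T as [->|Hy]; cbn [fst snd].
    + rewrite Rminus_diag, Rabs_R0. right; ring.
    + replace ((1 - cos (s * y)) / y ^ 2 - s ^ 2 / 2) with
        (- (cos (s * y) - 1 + (s * y) ^ 2 / 2) / y ^ 2) by (field; easy).
      apply Rabs_div_pow_le; [easy|]. rewrite Rabs_Ropp, pow2_abs.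
      destruct (sin_cos_taylor (s * y)) as [_ [_ [_ [H _]]]].
      eapply Rle_trans; [apply H|]. right. field.
  - rewrite dv_re_nonzero by easy.
    apply is_derive_loc_nonzero with (fun t => (1 - cos (s * t)) / t ^ 2); [easy| |].
    + intros y Hy. unfold v. now destruct Req_EM_T.
    + auto_derive; [apply (pow_nonzero t 2 Ht)|]. simpl. field. easy.
Qed.

Lemma is_derive_v_im s t : is_derive (fun u => snd (v s u)) t (dv_im s t).
Proof.
  destruct (Req_dec t 0) as [->|Ht].
  - unfold dv_im, w'im. rewrite Rmult_0_r. destruct Req_EM_T; [|easy].
    apply is_derive_sq_close with (s ^ 4 / 24). intros y.
    rewrite !Rminus_0_r. unfold v at 2. destruct Req_EM_T; [|easy].
    unfold v. destruct Req_EM_T as [->|Hy]; cbn [fst snd].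
    + rewrite Rmult_0_r, !Rminus_0_r, Rabs_R0. right; ring.
    + replace ((sin (s * y) - s * y) / y ^ 2 - 0 - s ^ 3 * - / 6 * y) with
        ((sin (s * y) - s * y + (s * y) ^ 3 / 6) / y ^ 2) by (field; easy).
      apply Rabs_div_pow_le; [easy|]. rewrite pow2_abs.
      destruct (sin_cos_taylor (s * y)) as [_ [_ [_ [_ H]]]].
      eapply Rle_trans; [apply H|]. right. field.
  - rewrite dv_im_nonzero by easy.
    apply is_derive_loc_nonzero with (fun t => (sin (s * t) - s * t) / t ^ 2); [easy| |].
    + intros y Hy. unfold v. now destruct Req_EM_T.
    + auto_derive; [apply (pow_nonzero t 2 Ht)|]. simpl. field. easy.
Qed.

Lemma DeriveC_v s t : DeriveC (v s) t = (dv_re s t, dv_im s t).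
Proof.
  unfold DeriveC. f_equal; apply is_derive_unique; [apply is_derive_v_re|apply is_derive_v_im].
Qed.

Lemma cont2_dv_re : cont2 dv_re.
Proof.
  unfold dv_re. apply cont2_mult; [cont2_tac|].
  apply (cont2_comp1 w're (fun s t => s * t)); [intros; apply w're_continuous|cont2_tac].
Qed.

Lemma cont2_dv_im : cont2 dv_im.
Proof.
  unfold dv_im. apply cont2_mult; [cont2_tac|].
  apply (cont2_comp1 w'im (fun s t => s * t)); [intros; apply w'im_continuous|cont2_tac].
Qed.

Definition dv_weight (s : R) : R := 12 * (1 + s ^ 2) ^ 2.

(** Decay in the product st is traded for decay in t by s^2(1+t^2) <= (1+s^2)(1+(st)^2). This uses
    two of the three factors s; the third is at most 1+s^2, whence the square in [dv_weight]. *)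
Lemma dv_bound_aux s t x : Rabs x <= 12 / (1 + (s * t) ^ 2) ->
  Rabs (s ^ 3 * x) <= dv_weight s / (1 + t ^ 2).
Proof.
  intros H. rewrite Rabs_mult, <- RPow_abs.
  pose proof (pow2_ge_0 (s * t)). pose proof (Rabs_pos s). pose proof (Rabs_pos x).
  assert (Ht : 0 < 1 + t ^ 2) by nra.
  apply Rmult_le_reg_r with (1 + t ^ 2); [easy|].
  unfold Rdiv. rewrite Rmult_assoc, (Rmult_assoc (dv_weight s)), Rinv_l, Rmult_1_r by lra.
  apply (Rmult_le_compat_r (1 + (s * t) ^ 2)) in H; [|lra].
  unfold Rdiv in H. rewrite Rmult_assoc, Rinv_l, Rmult_1_r in H by lra.
  assert (S2 : Rabs s ^ 2 = s ^ 2) by apply pow2_abs.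
  assert (K : s ^ 2 * (1 + t ^ 2) <= (1 + s ^ 2) * (1 + (s * t) ^ 2)).
  { rewrite Rpow_mult_distr. pose proof (pow2_ge_0 s). pose proof (pow2_ge_0 t).
    assert (0 <= s ^ 2 * (s ^ 2 * t ^ 2)) by (apply Rmult_le_pos; [easy|now apply Rmult_le_pos]). nra. }
  replace (Rabs s ^ 3) with (Rabs s * s ^ 2) by (rewrite <- S2; ring).
  replace (Rabs s * s ^ 2 * (Rabs x * (1 + t ^ 2))) with (Rabs s * Rabs x * (s ^ 2 * (1 + t ^ 2))) by ring.
  apply Rle_trans with (Rabs s * Rabs x * ((1 + s ^ 2) * (1 + (s * t) ^ 2))).
  { apply Rmult_le_compat_l; [nra|easy]. }
  replace (Rabs s * Rabs x * ((1 + s ^ 2) * (1 + (s * t) ^ 2))) with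
    (Rabs s * (1 + s ^ 2) * (Rabs x * (1 + (s * t) ^ 2))) by ring.
  unfold dv_weight.
  assert (Rabs s <= 1 + s ^ 2) by (rewrite <- S2; nra).
  apply Rle_trans with (Rabs s * (1 + s ^ 2) * 12).
  - apply Rmult_le_compat_l; nra.
  - nra.
Qed.

Lemma dv_re_bound s t : Rabs (dv_re s t) <= dv_weight s / (1 + t ^ 2).
Proof. apply dv_bound_aux, w're_bound. Qed.

Lemma dv_im_bound s t : Rabs (dv_im s t) <= dv_weight s / (1 + t ^ 2).
Proof. apply dv_bound_aux, w'im_bound. Qed.

(** * The kernel as a function of s, and integration by parts *)

Lemma pgrow_sin_lin t : pgrow (fun s => sin (s * t)).
Proof. apply pgrow_bounded with 1. intros. apply Rabs_le, SIN_bound. Qed.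

Lemma pgrow_cos_lin t : pgrow (fun s => cos (s * t)).
Proof. apply pgrow_bounded with 1. intros. apply Rabs_le, COS_bound. Qed.

Lemma pgrow_dv (k : R -> R -> R) t : (forall s t, Rabs (k s t) <= dv_weight s / (1 + t ^ 2)) ->
  pgrow (fun s => k s t).
Proof.
  intros H. exists 2%nat, 12. intros s. eapply Rle_trans; [apply H|].
  unfold dv_weight, Rdiv. rewrite <- (Rmult_1_r (12 * (1 + s ^ 2) ^ 2)) at 2.
  apply Rmult_le_compat_l; [pose proof (pow2_ge_0 (1 + s ^ 2)); lra|].
  rewrite <- Rinv_1. apply Rinv_le_contravar; nra.
Qed.

(** For fixed t the kernel is differentiated twice in s, after which no negative power of t remains.
    The first derivative [A] is recorded because it enters the boundary term of the integration by
    parts. Its growth bound may depend on t; the value t = 0 is treated apart, since the closed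
    formula divides by t. *)
Lemma dv_re_ODE t : exists A, (forall s, is_derive (fun s => dv_re s t) s (A s)) /\
  (forall s, is_derive A s (- (s * sin (s * t)))) /\ pgrow A.
Proof.
  destruct (Req_dec t 0) as [->|Ht].
  - exists (fun _ => 0). split; [|split].
    + intros s. apply is_derive_ext with (fun _ => 0); [|apply @is_derive_const].
      intros u. unfold dv_re, w're. rewrite Rmult_0_r. destruct Req_EM_T; [|easy]. symmetry; apply Rmult_0_r.
    + intros s. rewrite Rmult_0_r, sin_0, Rmult_0_r, Ropp_0. apply @is_derive_const.
    + apply pgrow_const.
  - exists (fun s => s * cos (s * t) * / t + sin (s * t) * - / t ^ 2). split; [|split].
    + intros s. apply is_derive_ext with (fun s => s * sin (s * t) / t ^ 2 - 2 * (1 - cos (s * t)) / t ^ 3).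
      { intros u. symmetry. now apply dv_re_nonzero. }
      auto_derive; [auto|]. field. easy.
    + intros s. auto_derive; [auto|]. field. easy.
    + repeat (apply pgrow_plus || apply pgrow_mult || apply pgrow_id || apply pgrow_const
        || apply pgrow_sin_lin || apply pgrow_cos_lin).
Qed.

Lemma dv_im_ODE t : exists A, (forall s, is_derive (fun s => dv_im s t) s (A s)) /\
  (forall s, is_derive A s (- (s * cos (s * t)))) /\ pgrow A.
Proof.
  destruct (Req_dec t 0) as [->|Ht].
  - exists (fun s => s ^ 2 * - / 2). split; [|split].
    + intros s. apply is_derive_ext with (fun s => s ^ 3 * - / 6).
      * intros u. unfold dv_im, w'im. rewrite Rmult_0_r. now destruct Req_EM_T.
      * auto_derive; [auto|]. field.
    + intros s. rewrite Rmult_0_r, cos_0. auto_derive; [auto|]. field.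
    + apply pgrow_mult; [apply pgrow_pow|apply pgrow_const].
  - exists (fun s => / t ^ 2 + (cos (s * t) * - / t ^ 2 + s * sin (s * t) * - / t)). split; [|split].
    + intros s. apply is_derive_ext with
        (fun s => (s * cos (s * t) - s) / t ^ 2 - 2 * (sin (s * t) - s * t) / t ^ 3).
      { intros u. symmetry. now apply dv_im_nonzero. }
      auto_derive; [auto|]. field. easy.
    + intros s. auto_derive; [auto|]. field. easy.
    + repeat (apply pgrow_plus || apply pgrow_mult || apply pgrow_id || apply pgrow_const
        || apply pgrow_sin_lin || apply pgrow_cos_lin).
Qed.

(** Both integrations by parts are done at once: phi' k - phi A has derivative phi'' k - phi a, and
    it vanishes at both infinities because phi and phi' decrease rapidly while k and A grow
    polynomially. *)
Lemma int_by_parts_twice phi k A a : schwartz phi ->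
  (forall s, is_derive k s (A s)) -> (forall s, is_derive A s (a s)) ->
  (forall s, continuous a s) -> pgrow k -> pgrow A -> pgrow a ->
  int (fun s => Derive_n phi 2 s * k s) = int (fun s => phi s * a s).
Proof.
  intros Hp Dk DA Ca Pk PA Pa.
  assert (Ck : forall s, continuous k s) by (intros s; apply (ex_derive_continuous k); exists (A s); apply Dk).
  assert (CA : forall s, continuous A s) by (intros s; apply (ex_derive_continuous A); exists (a s); apply DA).
  assert (D1 : dom (fun s => Derive_n phi 2 s * k s)) by now apply dom_schwartz_mult.
  assert (D2 : dom (fun s => phi s * a s)) by now apply (dom_schwartz_mult phi 0).
  assert (D3 : dom (fun s => Derive_n phi 1 s * k s - phi s * A s)).
  { apply dom_minus; [now apply dom_schwartz_mult|now apply (dom_schwartz_mult phi 0)]. }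
  pose proof (dom_minus _ _ D1 D2) as [C12 _].
  assert (Z : int (fun s => Derive_n phi 2 s * k s - phi s * a s) = 0).
  { apply (int_derive_zero _ _ D3); [|exact C12]. intros s.
    assert (E0 : is_derive phi s (Derive_n phi 1 s)) by apply Derive_correct, (proj1 Hp 0%nat).
    assert (E1 : is_derive (Derive_n phi 1) s (Derive_n phi 2 s)) by apply Derive_correct, (proj1 Hp 1%nat).
    replace (Derive_n phi 2 s * k s - phi s * a s) with
      (minus (plus (mult (Derive_n phi 2 s) (k s)) (mult (Derive_n phi 1 s) (A s)))
        (plus (mult (Derive_n phi 1 s) (A s)) (mult (phi s) (a s))))
      by (unfold minus, plus, mult, opp; simpl; ring).
    apply (is_derive_minus (fun s => Derive_n phi 1 s * k s) (fun s => phi s * A s)).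
    - apply (is_derive_mult (Derive_n phi 1) k); [easy|easy|]. intros; apply Rmult_comm.
    - apply (is_derive_mult phi A); [easy|easy|]. intros; apply Rmult_comm. }
  rewrite int_minus in Z by easy. lra.
Qed.

Lemma int_schwartz_dv_re phi t : schwartz phi ->
  int (fun s => Derive_n phi 2 s * dv_re s t) = int (fun s => phi s * - (s * sin (s * t))).
Proof.
  intros Hp. destruct (dv_re_ODE t) as [A [H1 [H2 H3]]].
  apply (int_by_parts_twice phi (fun s => dv_re s t) A); try easy.
  - intros s. apply (ex_derive_continuous (fun s => - (s * sin (s * t)))). auto_derive. auto.
  - apply pgrow_dv, dv_re_bound.
  - destruct (pgrow_mult _ _ (pgrow_const (-1)) (pgrow_mult _ _ pgrow_id (pgrow_sin_lin t))) as [k [C H]].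
    exists k, C. intros x. specialize (H x). now replace (- (x * sin (x * t))) with (-1 * (x * sin (x * t))) by ring.
Qed.

Lemma int_schwartz_dv_im phi t : schwartz phi ->
  int (fun s => Derive_n phi 2 s * dv_im s t) = int (fun s => phi s * - (s * cos (s * t))).
Proof.
  intros Hp. destruct (dv_im_ODE t) as [A [H1 [H2 H3]]].
  apply (int_by_parts_twice phi (fun s => dv_im s t) A); try easy.
  - intros s. apply (ex_derive_continuous (fun s => - (s * cos (s * t)))). auto_derive. auto.
  - apply pgrow_dv, dv_im_bound.
  - destruct (pgrow_mult _ _ (pgrow_const (-1)) (pgrow_mult _ _ pgrow_id (pgrow_cos_lin t))) as [k [C H]].
    exists k, C. intros x. specialize (H x). now replace (- (x * cos (x * t))) with (-1 * (x * cos (x * t))) by ring.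
Qed.

(** * The Banach space B_c *)

Lemma is_RInt_gen_pair (h : R -> C) (l1 l2 : R) :
  is_int (fun x => fst (h x)) l1 -> is_int (fun x => snd (h x)) l2 ->
  is_RInt_gen (V := C_R_NormedModule) h (Rbar_locally m_infty) (Rbar_locally p_infty) (l1, l2).
Proof.
  intros H1 H2 P [e He].
  specialize (H1 (fun y => ball l1 e y) (locally_ball l1 e)).
  specialize (H2 (fun y => ball l2 e y) (locally_ball l2 e)).
  unfold filtermapi in *. generalize (filter_and _ _ H1 H2). apply filter_imp.
  intros ab [[y1 [I1 B1]] [y2 [I2 B2]]].
  exists (y1, y2). split.
  - exact (is_RInt_fct_extend_pair (U := R_NormedModule) (V := R_NormedModule) h _ _ y1 y2 I1 I2).
  - apply He. now split.
Qed.

Definition cdom (h : R -> C) : Prop := dom (fun x => fst (h x)) /\ dom (fun x => snd (h x)).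

Lemma Rint_components h : cdom h ->
  Rint h = (int (fun x => fst (h x)), int (fun x => snd (h x))).
Proof.
  intros [H1 H2].
  exact (is_RInt_gen_unique (V := C_R_CompleteNormedModule) h (_, _)
    (is_RInt_gen_pair h _ _ (int_correct _ H1) (int_correct _ H2))).
Qed.

Lemma cdom_plus g h : cdom g -> cdom h -> cdom (fun x => Cplus (g x) (h x)).
Proof.
  intros [G1 G2] [H1 H2]. split; simpl.
  - apply (dom_plus _ _ G1 H1).
  - apply (dom_plus _ _ G2 H2).
Qed.

Lemma cdom_scal c h : cdom h -> cdom (fun x => Cmult c (h x)).
Proof.
  intros [H1 H2]. split; simpl.
  - apply (dom_minus _ _ (dom_scal (fst c) _ H1) (dom_scal (snd c) _ H2)).
  - apply (dom_plus _ _ (dom_scal (fst c) _ H2) (dom_scal (snd c) _ H1)).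
Qed.

Lemma Rint_plus g h : cdom g -> cdom h ->
  Rint (fun x => Cplus (g x) (h x)) = Cplus (Rint g) (Rint h).
Proof.
  intros Hg Hh. rewrite (Rint_components _ (cdom_plus _ _ Hg Hh)), !Rint_components by easy.
  destruct Hg as [G1 G2], Hh as [H1 H2]. unfold Cplus; simpl.
  f_equal; now apply int_plus.
Qed.

Lemma Rint_scal c h : cdom h -> Rint (fun x => Cmult c (h x)) = Cmult c (Rint h).
Proof.
  intros Hh. rewrite (Rint_components _ (cdom_scal c _ Hh)), Rint_components by easy.
  destruct Hh as [H1 H2]. unfold Cmult; simpl.
  rewrite int_minus, int_plus, !int_scal by (try apply dom_scal; easy). reflexivity.
Qed.

Lemma filterlim_C_iff {T} (F : (T -> Prop) -> Prop) (f : T -> C) (l : C) : Filter F ->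
  filterlim f F (locally l) <->
  filterlim (fun x => fst (f x)) F (locally (fst l)) /\
  filterlim (fun x => snd (f x)) F (locally (snd l)).
Proof.
  intros FF. split.
  - intros H. split; intros P [e He].
    + apply (H (fun z => P (fst z))). exists e. intros y [B1 _]. now apply He.
    + apply (H (fun z => P (snd z))). exists e. intros y [_ B2]. now apply He.
  - intros [H1 H2] P [e He].
    specialize (H1 _ (locally_ball (fst l) e)). specialize (H2 _ (locally_ball (snd l) e)).
    unfold filtermap in *. generalize (filter_and _ _ H1 H2). apply filter_imp.
    intros x [B1 B2]. apply He. now split.
Qed.

Lemma filterlim_R_plus {T} (F : (T -> Prop) -> Prop) (f g : T -> R) a b : Filter F ->
  filterlim f F (locally a) -> filterlim g F (locally b) ->
  filterlim (fun x => f x + g x) F (locally (a + b)).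
Proof.
  intros FF Hf Hg. apply (filterlim_comp_2 f g Rplus Hf Hg).
  apply (filterlim_plus (V := R_NormedModule) a b).
Qed.

Lemma filterlim_R_scal {T} (F : (T -> Prop) -> Prop) (f : T -> R) k a : Filter F ->
  filterlim f F (locally a) -> filterlim (fun x => k * f x) F (locally (k * a)).
Proof.
  intros FF Hf. apply (filterlim_comp _ _ _ f (fun y => k * y) _ _ _ Hf).
  apply (filterlim_scal_r (V := R_NormedModule) k a).
Qed.

Lemma filterlim_Cplus {T} (F : (T -> Prop) -> Prop) (f g : T -> C) a b : Filter F ->
  filterlim f F (locally a) -> filterlim g F (locally b) ->
  filterlim (fun x => Cplus (f x) (g x)) F (locally (Cplus a b)).
Proof.
  intros FF Hf Hg. apply filterlim_C_iff in Hf, Hg; try easy. apply filterlim_C_iff; [easy|].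
  split; simpl; now apply filterlim_R_plus.
Qed.

Lemma filterlim_Cscal {T} (F : (T -> Prop) -> Prop) (f : T -> C) c a : Filter F ->
  filterlim f F (locally a) -> filterlim (fun x => Cmult c (f x)) F (locally (Cmult c a)).
Proof.
  intros FF Hf. apply filterlim_C_iff in Hf; try easy. apply filterlim_C_iff; [easy|].
  destruct Hf as [H1 H2]. split; simpl.
  - apply filterlim_ext with (fun x => fst c * fst (f x) + (- snd c) * snd (f x)); [intros; ring|].
    replace (fst c * fst a - snd c * snd a) with (fst c * fst a + (- snd c) * snd a) by ring.
    apply filterlim_R_plus; [easy| |]; now apply filterlim_R_scal.
  - apply filterlim_R_plus; [easy| |]; now apply filterlim_R_scal.
Qed.

Lemma subspace_Bc : subspace Bc.
Proof.
  split; [|split].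
  - split; [|split].
    + intros x. apply (continuous_const (RtoC 0)).
    + exact (filterlim_const (F := Rbar_locally m_infty) (RtoC 0)).
    + exists (RtoC 0). exact (filterlim_const (F := Rbar_locally p_infty) (RtoC 0)).
  - intros u w [C1 [M1 [l1 P1]]] [C2 [M2 [l2 P2]]]. split; [|split].
    + intros x. apply (filterlim_Cplus (locally x) u w); [apply locally_filter|apply C1|apply C2].
    + replace (RtoC 0) with (Cplus (RtoC 0) (RtoC 0)) by ring. now apply filterlim_Cplus; [apply Rbar_locally_filter| |].
    + exists (Cplus l1 l2). now apply filterlim_Cplus; [apply Rbar_locally_filter| |].
  - intros c u [C1 [M1 [l1 P1]]]. split; [|split].
    + intros x. apply (filterlim_Cscal (locally x) u); [apply locally_filter|apply C1].
    + replace (RtoC 0) with (Cmult c (RtoC 0)) by ring. now apply filterlim_Cscal; [apply Rbar_locally_filter|].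
    + exists (Cmult c l1). now apply filterlim_Cscal; [apply Rbar_locally_filter|].
Qed.

Lemma bounded_of_limits (f : R -> R) la lb : (forall x, continuous f x) ->
  filterlim f (Rbar_locally m_infty) (locally la) ->
  filterlim f (Rbar_locally p_infty) (locally lb) -> exists B, forall x, Rabs (f x) <= B.
Proof.
  intros Cf La Lb.
  destruct (La _ (locally_ball la (mkposreal 1 Rlt_0_1))) as [a Ha].
  destruct (Lb _ (locally_ball lb (mkposreal 1 Rlt_0_1))) as [b Hb].
  destruct (bounded_continuity (V := R_NormedModule) f a b) as [M HM].
  { intros; apply Cf. }
  exists (Rmax M (Rmax (Rabs la + 1) (Rabs lb + 1))). intros x.
  assert (K : forall l, ball l 1 (f x) -> Rabs (f x) <= Rabs l + 1).
  { intros l Hl. change (Rabs (f x - l) < 1) in Hl.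
    replace (f x) with (l + (f x - l)) by ring. eapply Rle_trans; [apply Rabs_triang|lra]. }
  destruct (Rlt_dec x a) as [L|L].
  { eapply Rle_trans; [apply K, (Ha x L)|]. eapply Rle_trans; [apply Rmax_l|apply Rmax_r]. }
  destruct (Rlt_dec b x) as [L'|L'].
  { eapply Rle_trans; [apply K, (Hb x L')|]. eapply Rle_trans; [apply Rmax_r|apply Rmax_r]. }
  left. eapply Rlt_le_trans; [apply HM; lra|apply Rmax_l].
Qed.

Definition bdd_cont (f : R -> R) : Prop :=
  (forall x, continuous f x) /\ exists B, forall x, Rabs (f x) <= B.

Lemma Bc_re F : Bc F -> bdd_cont (fun x => fst (F x)).
Proof.
  intros [CF [M [l P]]]. apply filterlim_C_iff in M, P; try apply Rbar_locally_filter.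
  assert (C1 : forall x, continuous (fun x => fst (F x)) x).
  { intros x. apply (filterlim_C_iff (locally x) F (F x)); [apply locally_filter|apply CF]. }
  split; [exact C1|]. apply (bounded_of_limits _ _ _ C1 (proj1 M) (proj1 P)).
Qed.

Lemma Bc_im F : Bc F -> bdd_cont (fun x => snd (F x)).
Proof.
  intros [CF [M [l P]]]. apply filterlim_C_iff in M, P; try apply Rbar_locally_filter.
  assert (C1 : forall x, continuous (fun x => snd (F x)) x).
  { intros x. apply (filterlim_C_iff (locally x) F (F x)); [apply locally_filter|apply CF]. }
  split; [exact C1|]. apply (bounded_of_limits _ _ _ C1 (proj2 M) (proj2 P)).
Qed.

Lemma Bc_bounded F : Bc F -> exists B, forall x, Cmod (F x) <= B.
Proof.
  intros H. destruct (Bc_re F H) as [_ [B1 H1]]. destruct (Bc_im F H) as [_ [B2 H2]].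
  exists (sqrt 2 * Rmax B1 B2). intros x.
  eapply Rle_trans; [apply Cmod_2Rmax|].
  apply Rmult_le_compat_l; [apply sqrt_pos|]. apply Rmax_lub.
  - eapply Rle_trans; [apply H1|apply Rmax_l].
  - eapply Rle_trans; [apply H2|apply Rmax_r].
Qed.

(** [real] sends the infinite values of [Lub_Rbar] to 0. The bound excludes [p_infty] and the value
    at 0 excludes [m_infty], so that [supnorm] is the genuine supremum. *)
Lemma supnorm_lub F : (exists B, forall x, Cmod (F x) <= B) ->
  (forall x, Cmod (F x) <= supnorm F) /\
  (forall M, (forall x, Cmod (F x) <= M) -> supnorm F <= M).
Proof.
  intros [B HB]. unfold supnorm.
  destruct (Lub_Rbar_correct (fun r => exists x, r = Cmod (F x))) as [U L].
  set (l := Lub_Rbar (fun r => exists x, r = Cmod (F x))) in *.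
  assert (UB : forall M, (forall x, Cmod (F x) <= M) -> Rbar_le l M).
  { intros M HM. apply L. intros r [x ->]. apply HM. }
  pose proof (UB B HB) as HlB. pose proof (U (Cmod (F 0)) (ex_intro _ 0 eq_refl)) as Hl0.
  destruct l as [l| |]; try easy. split.
  - intros x. apply (U (Cmod (F x))). now exists x.
  - exact UB.
Qed.

Lemma supnorm_le F M : (forall x, Cmod (F x) <= M) -> supnorm F <= M.
Proof. intros H. apply supnorm_lub; [now exists M|easy]. Qed.

Lemma Cmod_le_supnorm F x : Bc F -> Cmod (F x) <= supnorm F.
Proof. intros H. apply supnorm_lub. now apply Bc_bounded. Qed.

Lemma norm_on_Bc : norm_on Bc supnorm.
Proof.
  destruct subspace_Bc as [_ [SA SS]].
  assert (P : forall u, Bc u -> 0 <= supnorm u).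
  { intros u H. eapply Rle_trans; [apply (Cmod_ge_0 (u 0))|now apply Cmod_le_supnorm]. }
  assert (S : forall c u, Bc u -> supnorm (scalf c u) <= Cmod c * supnorm u).
  { intros c u H. apply supnorm_le. intros x. unfold scalf. rewrite Cmod_mult.
    apply Rmult_le_compat_l; [apply Cmod_ge_0|now apply Cmod_le_supnorm]. }
  split; [exact P|split; [|split]].
  - intros u H E. apply functional_extensionality. intros x. apply Cmod_eq_0.
    apply Rle_antisym; [rewrite <- E; now apply Cmod_le_supnorm|apply Cmod_ge_0].
  - intros c u H. apply Rle_antisym; [now apply S|].
    destruct (Req_dec (Cmod c) 0) as [E|E].
    + rewrite E, Rmult_0_l. now apply P, SS.
    + assert (Hc : c <> RtoC 0) by (intros ->; apply E, Cmod_0).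
      (* The inequality [S], applied to the scalar [Cinv c] and the function [scalf c u], gives the
         reverse inequality for c. *)
      assert (K : u = scalf (Cinv c) (scalf c u)).
      { apply functional_extensionality. intros x. unfold scalf.
        rewrite Cmult_assoc, Cinv_l, Cmult_1_l by easy. reflexivity. }
      pose proof (S (Cinv c) (scalf c u) (SS c u H)) as L. rewrite <- K, Cmod_inv in L by easy.
      pose proof (Cmod_ge_0 c).
      apply (Rmult_le_compat_l (Cmod c)) in L; [|easy].
      rewrite <- Rmult_assoc, Rinv_r, Rmult_1_l in L by easy. exact L.
  - intros u w Hu Hw. apply supnorm_le. intros x. eapply Rle_trans; [apply Cmod_triangle|].
    apply Rplus_le_compat; now apply Cmod_le_supnorm.
Qed.

Lemma lim_pinfty_unique F (l : C) : filterlim F (Rbar_locally p_infty) (locally l) -> lim_pinfty F = l.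
Proof.
  intros H. apply filterlim_C_iff in H; [|apply Rbar_locally_filter]. destruct H as [H1 H2], l as [l1 l2].
  unfold lim_pinfty. f_equal.
  - rewrite (is_lim_unique (fun x => fst (F x)) p_infty l1); [easy|exact H1].
  - rewrite (is_lim_unique (fun x => snd (F x)) p_infty l2); [easy|exact H2].
Qed.

Lemma lim_pinfty_correct F : Bc F -> filterlim F (Rbar_locally p_infty) (locally (lim_pinfty F)).
Proof. intros [_ [_ [l H]]]. now rewrite (lim_pinfty_unique F l H). Qed.

Lemma subf_addf {A : Type} (u w : A -> C) : subf u w = addf u (scalf (RtoC (-1)) w).
Proof. apply functional_extensionality. intros x. unfold subf, addf, scalf. ring. Qed.

Lemma subspace_subf {A : Type} (X : (A -> C) -> Prop) u w :
  subspace X -> X u -> X w -> X (subf u w).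
Proof. intros [_ [XA XS]] Hu Hw. rewrite subf_addf. auto. Qed.

(** The uniform limit exists in the complete space of all functions into C. Continuity and both
    limits at infinity then pass to it by interchanging the uniform limit with the limit in x. *)
Lemma complete_Bc : complete_on Bc supnorm.
Proof.
  intros u Hu HC.
  assert (L : exists g : R -> C, filterlim (fun k => u k : @fct_CompleteSpace R C_R_CompleteNormedModule)
     eventually (locally (T := fct_UniformSpace R C_UniformSpace) g)).
  { apply (filterlim_locally_cauchy (U := @fct_CompleteSpace R C_R_CompleteNormedModule) (F := eventually)).
    intros eps. destruct (HC eps (cond_pos eps)) as [N HN].
    exists (fun k => (N <= k)%nat). split; [now exists N|].
    intros p q Hp Hq x. apply C_NormedModule_mixin_compat1.
    change (Cmod (subf (u q) (u p) x) < eps).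
    eapply Rle_lt_trans; [apply Cmod_le_supnorm; now apply subspace_subf; [apply subspace_Bc| |]|now apply HN]. }
  destruct L as [g Hg].
  assert (Pt : forall x, filterlim (fun k => u k x) eventually (locally (g x))).
  { intros x P [e He]. destruct (Hg _ (locally_ball (T := fct_UniformSpace R C_UniformSpace) g e)) as [N HN].
    exists N. intros n Hn. apply He, HN. exact Hn. }
  assert (Bg : Bc g).
  { split; [|split].
    - intros x.
      apply (filterlim_switch_1 (U := C_UniformSpace) eventually _ (locally x) _ u g (fun k => u k x) (g x)); auto.
      intros k. apply Hu.
    - apply (filterlim_switch_1 (U := C_UniformSpace) eventually _ (Rbar_locally m_infty) _ u g (fun _ => RtoC 0) (RtoC 0)); auto.
      + intros k. apply Hu.
      + apply filterlim_const.
    (* At plus infinity the limit of g is not known beforehand; completeness of C supplies it as the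
       limit of the numbers [lim_pinfty (u k)]. *)
    - destruct (filterlim_switch (U := C_R_CompleteNormedModule) eventually _ (Rbar_locally p_infty) _ u g
        (fun k => lim_pinfty (u k))) as [l [_ Hl]]; auto.
      + intros k. now apply lim_pinfty_correct.
      + now exists l. }
  exists g. split; [exact Bg|]. intros eps He.
  assert (H2 : 0 < sqrt 2) by (apply sqrt_lt_R0; lra).
  (* Balls of C are taken componentwise, which costs a factor sqrt 2 against [Cmod]. The half turns
     the non-strict bound on the supremum into a strict one. *)
  assert (He' : 0 < eps / 2 / sqrt 2) by (repeat apply Rdiv_lt_0_compat; lra).
  destruct (Hg _ (locally_ball (T := fct_UniformSpace R C_UniformSpace) g (mkposreal _ He'))) as [N HN].
  exists N. intros k Hk. apply Rle_lt_trans with (eps / 2); [|lra].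
  apply supnorm_le. intros x. left.
  replace (eps / 2) with (sqrt 2 * (eps / 2 / sqrt 2)) by (field; lra).
  apply (C_NormedModule_mixin_compat2 (g x) (u k x) (mkposreal _ He')). apply HN. exact Hk.
Qed.

Lemma banach_Bc : banach Bc supnorm.
Proof. split; [apply subspace_Bc|split; [apply norm_on_Bc|apply complete_Bc]]. Qed.

(** * Isometric isomorphisms *)

Lemma iso_via_compose {A B D : Type} (S : (B -> C) -> (D -> C)) (T : (A -> C) -> (B -> C))
  X nX Y nY Z nZ :
  isometric_iso_via T X nX Y nY -> isometric_iso_via S Y nY Z nZ ->
  isometric_iso_via (fun u => S (T u)) X nX Z nZ.
Proof.
  intros [T1 [T2 [T3 [T4 [T5 T6]]]]] [S1 [S2 [S3 [S4 [S5 S6]]]]].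
  repeat split.
  - auto.
  - intros z Hz. destruct (S2 z Hz) as [y [Hy Ey]]. destruct (T2 y Hy) as [x [Hx Ex]].
    exists x. split; [easy|]. now rewrite Ex.
  - intros u w Hu Hw E. apply T3; auto.
  - intros u w Hu Hw. rewrite T4 by easy. auto.
  - intros c u Hu. rewrite T5 by easy. auto.
  - intros u Hu. rewrite S6; auto.
Qed.

Lemma iso_via_inverse {A B : Type} (S : (B -> C) -> (A -> C)) (T : (A -> C) -> (B -> C))
  X nX Y nY : subspace X -> isometric_iso_via T X nX Y nY ->
  (forall y, Y y -> X (S y) /\ T (S y) = y) -> isometric_iso_via S Y nY X nX.
Proof.
  intros [_ [XA XS]] [T1 [T2 [T3 [T4 [T5 T6]]]]] H.
  assert (ST : forall x, X x -> S (T x) = x).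
  { intros x Hx. apply T3; [now apply H, T1|easy|]. now apply H, T1. }
  assert (YA : forall u w, Y u -> Y w -> T (addf (S u) (S w)) = addf u w).
  { intros u w Hu Hw. destruct (H u Hu) as [Xu Eu]. destruct (H w Hw) as [Xw Ew].
    rewrite T4 by easy. now rewrite Eu, Ew. }
  assert (YS : forall c u, Y u -> T (scalf c (S u)) = scalf c u).
  { intros c u Hu. destruct (H u Hu) as [Xu Eu]. rewrite T5 by easy. now rewrite Eu. }
  repeat split.
  - intros y Hy. now apply H.
  - intros x Hx. exists (T x). split; [now apply T1|now apply ST].
  - intros u w Hu Hw E. rewrite <- (proj2 (H u Hu)), <- (proj2 (H w Hw)). now rewrite E.
  - intros u w Hu Hw. rewrite <- YA by easy. apply ST. apply XA; now apply H.
  - intros c u Hu. rewrite <- YS by easy. apply ST. apply XS. now apply H.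
  - intros y Hy. destruct (H y Hy) as [Xy Ey]. rewrite <- T6 by easy. now rewrite Ey.
Qed.

Lemma isometric_iso_sym {A B : Type} X nX Y nY : subspace X ->
  @isometric_iso A B X nX Y nY -> isometric_iso Y nY X nX.
Proof.
  intros SX [T HT].
  exists (fun y => epsilon (inhabits zerof) (fun u => X u /\ T u = y)).
  apply (iso_via_inverse _ T); [easy|easy|]. intros y Hy.
  apply epsilon_spec. now apply HT.
Qed.

Lemma isometric_iso_trans {A B D : Type} X nX Y nY Z nZ :
  @isometric_iso A B X nX Y nY -> @isometric_iso B D Y nY Z nZ -> isometric_iso X nX Z nZ.
Proof.
  intros [T HT] [S HS]. exists (fun u => S (T u)). now apply iso_via_compose with Y nY.
Qed.

(** Surjectivity of T presents every element of Y as an image, so even the subspace property is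
    inherited. Completeness requires preimages of a whole sequence simultaneously, hence the choice
    operator. *)
Lemma banach_transfer {A B : Type} (T : (A -> C) -> (B -> C)) X nX Y nY :
  banach X nX -> isometric_iso_via T X nX Y nY -> banach Y nY.
Proof.
  intros [SX [[N0 [N1 [N2 N3]]] CX]] [T1 [T2 [T3 [T4 [T5 T6]]]]].
  pose proof SX as [X0 [XA XS]].
  assert (XB : forall u w, X u -> X w -> X (subf u w)) by (intros; now apply subspace_subf).
  assert (TB : forall u w, X u -> X w -> T (subf u w) = subf (T u) (T w)).
  { intros u w Hu Hw. rewrite !subf_addf, T4, T5; auto. }
  assert (T0 : T zerof = zerof).
  { replace (@zerof A) with (scalf (RtoC 0) (@zerof A)) at 1.
    - rewrite T5 by easy. apply functional_extensionality. intros b. unfold scalf, zerof. ring.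
    - apply functional_extensionality. intros b. unfold scalf, zerof. ring. }
  split; [|split].
  - split; [|split].
    + rewrite <- T0. auto.
    + intros u w Hu Hw. destruct (T2 u Hu) as [x [Hx <-]]. destruct (T2 w Hw) as [y [Hy <-]].
      rewrite <- T4 by easy. auto.
    + intros c u Hu. destruct (T2 u Hu) as [x [Hx <-]]. rewrite <- T5 by easy. auto.
  - split; [|split; [|split]].
    + intros u Hu. destruct (T2 u Hu) as [x [Hx <-]]. rewrite T6; auto.
    + intros u Hu E. destruct (T2 u Hu) as [x [Hx <-]]. rewrite T6 in E by easy.
      now rewrite (N1 x Hx E).
    + intros c u Hu. destruct (T2 u Hu) as [x [Hx <-]]. rewrite <- T5, !T6; auto.
    + intros u w Hu Hw. destruct (T2 u Hu) as [x [Hx <-]]. destruct (T2 w Hw) as [y [Hy <-]].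
      rewrite <- T4, !T6; auto.
  - intros u Hu HC.
    set (x := fun k => proj1_sig (constructive_indefinite_description _ (T2 (u k) (Hu k)))).
    assert (Hx : forall k, X (x k) /\ T (x k) = u k).
    { intros k. unfold x. now destruct constructive_indefinite_description. }
    destruct (CX x) as [l [Xl Hl]].
    + intros k. apply Hx.
    + intros eps He. destruct (HC eps He) as [N HN]. exists N. intros p q Hp Hq.
      rewrite <- T6 by (apply XB; apply Hx). rewrite TB by apply Hx.
      rewrite (proj2 (Hx p)), (proj2 (Hx q)). auto.
    + exists (T l). split; [auto|]. intros eps He. destruct (Hl eps He) as [N HN]. exists N.
      intros k Hk. rewrite <- (proj2 (Hx k)), <- TB, T6; [auto| |apply Hx|easy].
      apply XB; [apply Hx|easy].
Qed.

Definition linear_on {A B : Type} (X : (A -> C) -> Prop) (T : (A -> C) -> (B -> C)) : Prop :=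
  (forall u w, X u -> X w -> T (addf u w) = addf (T u) (T w)) /\
  (forall c u, X u -> T (scalf c u) = scalf c (T u)).

Lemma linear_on_injective {A B : Type} X (T : (A -> C) -> (B -> C)) :
  subspace X -> linear_on X T -> (forall u, X u -> T u = zerof -> u = zerof) ->
  forall u w, X u -> X w -> T u = T w -> u = w.
Proof.
  intros SX [TA TS] K u w Hu Hw E.
  assert (Z : subf u w = zerof).
  { apply K; [now apply subspace_subf|]. destruct SX as [_ [XA XS]].
    rewrite subf_addf, TA, TS, E by auto.
    apply functional_extensionality. intros b. unfold addf, scalf, zerof. ring. }
  apply functional_extensionality. intros a. apply (f_equal (fun f => f a)) in Z.
  unfold subf, zerof in Z.
  replace (u a) with (Cplus (Cminus (u a) (w a)) (w a)) by ring.
  rewrite Z. ring.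
Qed.

(** The target space and norm have exactly the shape of the definitions of [Cc], [norm1] and of
    [Dc], [norm2]. Injectivity forces the preimage picked by [epsilon] for T u to be u itself, which
    gives the isometry. *)
Lemma iso_via_image {A B : Type} X nX (T : (A -> C) -> (B -> C)) :
  linear_on X T -> (forall u w, X u -> X w -> T u = T w -> u = w) ->
  isometric_iso_via T X nX (fun y => exists u, X u /\ y = T u)
    (fun y => nX (epsilon (inhabits zerof) (fun u => X u /\ y = T u))).
Proof.
  intros [TA TS] TI. repeat split; auto.
  - intros u Hu. now exists u.
  - intros y [u [Hu ->]]. now exists u.
  - intros u Hu. f_equal.
    destruct (epsilon_spec (inhabits zerof) (fun w => X w /\ T u = T w)) as [H1 H2].
    + now exists u.
    + now apply TI.
Qed.

(** The substitution x -> -x annihilates each symmetric truncation. This is the parity argument that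
    makes one component of J vanish for even and for odd test functions. *)
Lemma int_odd f : dom f -> (forall x, f (- x) = - f x) -> int f = 0.
Proof.
  intros Hf O. pose proof (int_lim_seq f Hf) as L. destruct Hf as [Cf _].
  assert (Z : forall n, RInt f (- INR n) (INR n) = 0).
  { intros n.
    assert (K : is_RInt f (- INR n) (- - INR n) (RInt f (- INR n) (INR n))).
    { rewrite Ropp_involutive. apply (RInt_correct f), ex_RInt_cont, Cf. }
    apply is_RInt_comp_opp in K.
    apply (is_RInt_ext _ f) in K.
    - apply (is_RInt_unique (V := R_CompleteNormedModule)) in K. rewrite (RInt_swap_cont f (- INR n) (INR n) Cf) in K. lra.
    - intros x _. change (- f (- x) = f x). rewrite O. ring. }
  apply is_lim_seq_unique in L. rewrite (Lim_seq_ext _ (fun _ => 0)), Lim_seq_const in L by exact Z.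
  now injection L.
Qed.

(** * Injectivity of F |-> F' and completeness of A_c *)

Lemma dom_bdd_cont_mult f g : bdd_cont f -> dom g -> dom (fun x => f x * g x).
Proof. intros [Cf [B HB]]. now apply dom_bounded_mult with B. Qed.

Lemma gauss_derivative_orthogonal_zero f : bdd_cont f ->
  filterlim f (Rbar_locally m_infty) (locally 0) ->
  (forall m x, 0 < m -> int (fun t => f t * ((t - x) * gauss m x t)) = 0) ->
  forall t, f t = 0.
Proof.
  intros [Cf [B HB]] L H t.
  pose proof (gauss_derivative_orthogonal_const f B Cf HB H) as K.
  apply (filterlim_locally_unique (V := R_NormedModule) (F := Rbar_locally m_infty) f); [|exact L].
  apply filterlim_ext with (fun _ => f t); [intros; apply K|apply filterlim_const].
Qed.

Lemma cdom_real_mult (r : R -> R) F : dom (fun x => r x * fst (F x)) ->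
  dom (fun x => r x * snd (F x)) -> cdom (fun x => Cmult (RtoC (r x)) (F x)).
Proof.
  intros H1 H2. split; simpl.
  - apply dom_ext with (fun x => r x * fst (F x)); [intros; ring|easy].
  - apply dom_ext with (fun x => r x * snd (F x)); [intros; ring|easy].
Qed.

Lemma Rint_real_mult (r : R -> R) F : dom (fun x => r x * fst (F x)) ->
  dom (fun x => r x * snd (F x)) ->
  Rint (fun x => Cmult (RtoC (r x)) (F x)) =
  (int (fun x => r x * fst (F x)), int (fun x => r x * snd (F x))).
Proof.
  intros H1 H2. rewrite Rint_components by now apply cdom_real_mult.
  f_equal; apply int_ext; intros x; simpl; ring.
Qed.

Lemma on_schwartz_eq g phi : schwartz phi -> on_schwartz g phi = g phi.
Proof. intros H. unfold on_schwartz. now destruct excluded_middle_informative. Qed.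

Lemma on_schwartz_add g h k : (forall phi, schwartz phi -> g phi = Cplus (h phi) (k phi)) ->
  on_schwartz g = addf (on_schwartz h) (on_schwartz k).
Proof.
  intros H. apply functional_extensionality. intros phi. unfold addf, on_schwartz.
  destruct excluded_middle_informative; [now apply H|ring].
Qed.

Lemma on_schwartz_scal c g h : (forall phi, schwartz phi -> g phi = Cmult c (h phi)) ->
  on_schwartz g = scalf c (on_schwartz h).
Proof.
  intros H. apply functional_extensionality. intros phi. unfold scalf, on_schwartz.
  destruct excluded_middle_informative; [now apply H|ring].
Qed.

Lemma dom_Derive_mult phi f : schwartz phi -> bdd_cont f -> dom (fun x => Derive phi x * f x).
Proof.
  intros Hp [Cf [B HB]]. apply (dom_schwartz_mult phi 1); [easy|easy|]. now apply pgrow_bounded with B.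
Qed.

Lemma cdom_dderiv phi F : schwartz phi -> Bc F -> cdom (fun x => Cmult (RtoC (Derive phi x)) (F x)).
Proof.
  intros Hp HF. apply cdom_real_mult; apply dom_Derive_mult; try easy; [now apply Bc_re|now apply Bc_im].
Qed.


Lemma linear_dderiv : linear_on Bc dderiv.
Proof.
  split.
  - intros u w Hu Hw. apply on_schwartz_add. intros phi Hp.
    transitivity (Copp (Cplus (Rint (fun x => Cmult (RtoC (Derive phi x)) (u x)))
      (Rint (fun x => Cmult (RtoC (Derive phi x)) (w x))))); [|ring].
    rewrite <- Rint_plus by now apply cdom_dderiv.
    do 2 f_equal. apply functional_extensionality. intros x. unfold addf. ring.
  - intros c u Hu. apply on_schwartz_scal. intros phi Hp.
    transitivity (Copp (Cmult c (Rint (fun x => Cmult (RtoC (Derive phi x)) (u x))))); [|ring].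
    rewrite <- Rint_scal by now apply cdom_dderiv.
    do 2 f_equal. apply functional_extensionality. intros x. unfold scalf. ring.
Qed.

Lemma schwartz_gauss m x : 0 < m -> schwartz (gauss m x).
Proof. intros Hm. apply (gauss_poly_schwartz m (2 * m * x) 0); [easy|apply gauss_poly_gauss]. Qed.

Lemma int_Derive_gauss m x f : 0 < m -> bdd_cont f ->
  int (fun t => Derive (gauss m x) t * f t) = - (2 * m) * int (fun t => f t * ((t - x) * gauss m x t)).
Proof.
  intros Hm Hf. rewrite <- int_scal.
  - apply int_ext. intros t.
    rewrite (is_derive_unique _ _ _ (is_derive_gauss m x t)). ring.
  - apply dom_bdd_cont_mult; [easy|].
    apply (gauss_poly_dom m (2 * m * x) 0); [easy|apply gauss_poly_central1].
Qed.

Lemma Bc_zero F : Bc F ->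
  (forall m x, 0 < m -> int (fun t => fst (F t) * ((t - x) * gauss m x t)) = 0) ->
  (forall m x, 0 < m -> int (fun t => snd (F t) * ((t - x) * gauss m x t)) = 0) ->
  F = zerof.
Proof.
  intros HF H1 H2. pose proof HF as [_ [M _]].
  apply filterlim_C_iff in M; [|apply Rbar_locally_filter]. destruct M as [M1 M2].
  apply functional_extensionality. intros t. apply injective_projections.
  - exact (gauss_derivative_orthogonal_zero _ (Bc_re F HF) M1 H1 t).
  - exact (gauss_derivative_orthogonal_zero _ (Bc_im F HF) M2 H2 t).
Qed.

Lemma dderiv_kernel F : Bc F -> dderiv F = zerof -> F = zerof.
Proof.
  intros HF E.
  assert (K : forall m x, 0 < m ->
    int (fun t => Derive (gauss m x) t * fst (F t)) = 0 /\
    int (fun t => Derive (gauss m x) t * snd (F t)) = 0).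
  { intros m x Hm. pose proof (schwartz_gauss m x Hm) as Hp.
    apply (f_equal (fun d => d (gauss m x))) in E. unfold dderiv, zerof in E.
    rewrite on_schwartz_eq in E by easy.
    rewrite Rint_real_mult in E by (apply dom_Derive_mult; [easy|first [now apply Bc_re | now apply Bc_im]]).
    injection E as E1 E2. lra. }
  apply Bc_zero; [easy| |]; intros m x Hm; destruct (K m x Hm) as [K1 K2].
  - rewrite int_Derive_gauss in K1 by (try apply Bc_re; easy).
    apply Rmult_integral in K1. destruct K1; [lra|easy].
  - rewrite int_Derive_gauss in K2 by (try apply Bc_im; easy).
    apply Rmult_integral in K2. destruct K2; [lra|easy].
Qed.

Lemma dderiv_injective F G : Bc F -> Bc G -> dderiv F = dderiv G -> F = G.
Proof.
  apply linear_on_injective; [apply subspace_Bc|apply linear_dderiv|apply dderiv_kernel].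
Qed.

Lemma prim_spec f : Ac f -> Bc (prim f) /\ f = dderiv (prim f).
Proof. intros Hf. unfold prim. now apply epsilon_spec. Qed.

Lemma prim_dderiv F : Bc F -> prim (dderiv F) = F.
Proof.
  intros HF. destruct (prim_spec (dderiv F)) as [H1 H2]; [now exists F|].
  apply dderiv_injective; [easy|easy|]. now rewrite <- H2.
Qed.

Lemma iso_dderiv : isometric_iso_via dderiv Bc supnorm Ac alex.
Proof.
  destruct linear_dderiv as [DA DS]. repeat split; auto.
  - intros F HF. now exists F.
  - intros f [F [HF ->]]. now exists F.
  - exact dderiv_injective.
  - intros F HF. unfold alex. now rewrite prim_dderiv.
Qed.

Lemma iso_prim : isometric_iso_via prim Ac alex Bc supnorm.
Proof.
  apply (iso_via_inverse prim dderiv); [apply subspace_Bc|apply iso_dderiv|].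
  intros f Hf. now destruct (prim_spec f Hf).
Qed.

Lemma banach_Ac : banach Ac alex.
Proof. apply (banach_transfer dderiv Bc supnorm); [apply banach_Bc|apply iso_dderiv]. Qed.

(** * The transform Omega_f as a Stieltjes integral *)

Lemma is_lim_inv_bound f K : (forall t, 1 < t -> Rabs (f t) <= K / t) ->
  filterlim f (Rbar_locally p_infty) (locally 0).
Proof.
  intros H P [e He].
  assert (HK : 0 <= K).
  { assert (L : 1 < 2) by lra. specialize (H 2 L). pose proof (Rabs_pos (f 2)). lra. }
  exists (Rmax 1 (K / e)). intros t Ht.
  pose proof (Rmax_l 1 (K / e)). pose proof (Rmax_r 1 (K / e)). pose proof (cond_pos e).
  apply He. change (Rabs (f t - 0) < e). rewrite Rminus_0_r.
  eapply Rle_lt_trans; [apply H; lra|].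
  assert (L : K / e < t) by lra.
  apply (Rmult_lt_compat_r e) in L; [|easy].
  unfold Rdiv in L. rewrite Rmult_assoc, Rinv_l, Rmult_1_r in L by lra.
  apply Rmult_lt_reg_r with t; [lra|].
  unfold Rdiv. rewrite Rmult_assoc, Rinv_l, Rmult_1_r by lra. lra.
Qed.

(** This removes the boundary term F(oo) v_s(oo) from the pairing and leaves only the Stieltjes
    integral. The imaginary part contains -s/t, so the decay is of order 1/t in general. *)
Lemma lim_pinfty_v s : lim_pinfty (v s) = RtoC 0.
Proof.
  apply lim_pinfty_unique. apply filterlim_C_iff; [apply Rbar_locally_filter|]. simpl. split.
  - apply is_lim_inv_bound with 2. intros t Ht. unfold v. destruct Req_EM_T; [lra|]. cbn [fst].
    replace ((1 - cos (s * t)) / t ^ 2) with ((1 - cos (s * t)) / t / t) by (field; easy).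
    pose proof (COS_bound (s * t)).
    unfold Rdiv. rewrite Rabs_mult, (Rabs_pos_eq (/ t)) by (left; apply Rinv_0_lt_compat; lra).
    apply Rmult_le_compat_r; [left; apply Rinv_0_lt_compat; lra|].
    rewrite Rabs_pos_eq.
    + apply Rle_trans with (2 * / t); [apply Rmult_le_compat_r; [left; apply Rinv_0_lt_compat|]; lra|].
      rewrite <- (Rmult_1_r 2) at 2. apply Rmult_le_compat_l; [lra|]. rewrite <- Rinv_1.
      apply Rinv_le_contravar; lra.
    + apply Rmult_le_pos; [lra|left; apply Rinv_0_lt_compat; lra].
  - apply is_lim_inv_bound with (1 + Rabs s). intros t Ht. unfold v. destruct Req_EM_T; [lra|]. cbn [snd].
    replace ((sin (s * t) - s * t) / t ^ 2) with ((sin (s * t) / t - s) / t) by (field; easy).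
    assert (0 < / t <= 1).
    { split; [apply Rinv_0_lt_compat; lra|]. rewrite <- Rinv_1. apply Rinv_le_contravar; lra. }
    unfold Rdiv. rewrite Rabs_mult, (Rabs_pos_eq (/ t)) by lra.
    apply Rmult_le_compat_r; [lra|].
    eapply Rle_trans; [apply Rabs_triang|]. rewrite Rabs_Ropp. apply Rplus_le_compat_r.
    rewrite Rabs_mult, (Rabs_pos_eq (/ t)) by lra.
    assert (Rabs (sin (s * t)) <= 1) by apply Rabs_le, SIN_bound.
    pose proof (Rabs_pos (sin (s * t))). nra.
Qed.

Definition kernel_bound (k : R -> R -> R) : Prop :=
  cont2 k /\ forall s t, Rabs (k s t) <= dv_weight s / (1 + t ^ 2).

Lemma kernel_bound_re : kernel_bound dv_re.
Proof. split; [apply cont2_dv_re|apply dv_re_bound]. Qed.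

Lemma kernel_bound_im : kernel_bound dv_im.
Proof. split; [apply cont2_dv_im|apply dv_im_bound]. Qed.

Lemma kernel_dom k s : kernel_bound k -> dom (k s).
Proof. intros [Ck Bk]. split; [now apply cont2_r|]. exists (dv_weight s). intros t. apply Bk. Qed.

Lemma kernel_loc_dom k f : kernel_bound k -> bdd_cont f -> loc_dom (fun s t => f t * k s t).
Proof.
  intros [Ck Bk] [Cf [B HB]] r. exists (B * dv_weight r). intros s Hs t.
  rewrite Rabs_mult. unfold Rdiv. rewrite Rmult_assoc.
  apply Rmult_le_compat; try apply Rabs_pos; [apply HB|].
  eapply Rle_trans; [apply Bk|].
  apply Rmult_le_compat_r; [left; apply Rinv_0_lt_compat; nra|].
  unfold dv_weight. apply Rmult_le_compat_l; [lra|]. apply pow_incr.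
  assert (s ^ 2 <= r ^ 2); [|pose proof (pow2_ge_0 s); lra].
  rewrite <- (pow2_abs s). apply pow_incr. split; [apply Rabs_pos|easy].
Qed.

Definition kernel_int (k : R -> R -> R) (f : R -> R) (s : R) : R := int (fun t => f t * k s t).

Lemma cont2_kernel k f : kernel_bound k -> bdd_cont f -> cont2 (fun s t => f t * k s t).
Proof. intros [Ck _] [Cf _]. apply cont2_mult; [now apply cont2_snd|easy]. Qed.

Lemma kernel_int_continuous k f s : kernel_bound k -> bdd_cont f -> continuous (kernel_int k f) s.
Proof.
  intros Hk Hf. apply (continuous_int_param (fun s t => f t * k s t)).
  - now apply cont2_kernel.
  - now apply kernel_loc_dom.
Qed.

Lemma kernel_int_pgrow k f : kernel_bound k -> bdd_cont f -> pgrow (kernel_int k f).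
Proof.
  intros Hk Hf. pose proof Hf as [Cf [B HB]].
  exists 2%nat, (B * 12 * PI). intros s. unfold kernel_int.
  eapply Rle_trans; [apply (int_bound (B * dv_weight s))|].
  - apply cont2_r with (f := fun s t => f t * k s t). now apply cont2_kernel.
  - intros t. rewrite Rabs_mult. unfold Rdiv. rewrite Rmult_assoc.
    apply Rmult_le_compat; try apply Rabs_pos; [apply HB|apply Hk].
  - unfold dv_weight. right; ring.
Qed.

(** The kernel grows polynomially in s, but phi'' times [dv_weight] is still dominated by M/(1+s^2).
    With |f| <= B the double integrand has the product majorant with constant B M, and Fubini
    applies. *)
Lemma int_schwartz_kernel phi k f : schwartz phi -> kernel_bound k -> bdd_cont f ->
  int (fun s => Derive_n phi 2 s * kernel_int k f s) =
  int (fun t => f t * int (fun s => Derive_n phi 2 s * k s t)) /\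
  dom (fun t => f t * int (fun s => Derive_n phi 2 s * k s t)).
Proof.
  intros Hp Hk Hf. pose proof Hf as [Cf [B HB]]. pose proof Hk as [Ck Bk].
  assert (HW : pgrow dv_weight).
  { exists 2%nat, 12. intros s. unfold dv_weight. right. apply Rabs_pos_eq.
    pose proof (pow2_ge_0 (1 + s ^ 2)). lra. }
  destruct (rapid_dominated _ (rapid_mult_pgrow _ _ (schwartz_rapid phi 2 Hp) HW)) as [M HM].
  set (F := fun s t => Derive_n phi 2 s * (f t * k s t)).
  assert (CF : cont2 F).
  { apply cont2_mult; [|now apply cont2_kernel].
    apply cont2_fst. intros; now apply schwartz_continuous. }
  assert (DF : dominated2 (B * M) F).
  { intros s t. unfold F. specialize (HM s). specialize (Bk s t).
    replace (B * M / ((1 + s ^ 2) * (1 + t ^ 2))) with (B * (M / (1 + s ^ 2) * / (1 + t ^ 2)))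
      by (field; split; nra).
    rewrite <- Rmult_assoc, (Rmult_comm _ (f t)), Rmult_assoc, Rabs_mult.
    apply Rmult_le_compat; try apply Rabs_pos; [apply HB|].
    assert (Wpos : 0 < dv_weight s) by (unfold dv_weight; apply Rmult_lt_0_compat; [lra|apply pow_lt; nra]).
    assert (0 < / (1 + t ^ 2)) by (apply Rinv_0_lt_compat; nra).
    cbv beta in HM. rewrite Rabs_mult in HM. rewrite Rabs_mult. rewrite (Rabs_pos_eq (dv_weight s)) in HM by lra.
    apply Rle_trans with (Rabs (Derive_n phi 2 s) * (dv_weight s / (1 + t ^ 2))).
    - apply Rmult_le_compat_l; [apply Rabs_pos|easy].
    - unfold Rdiv. rewrite <- Rmult_assoc. apply Rmult_le_compat_r; [lra|exact HM]. }
  assert (E1 : forall s, Derive_n phi 2 s * kernel_int k f s = int (F s)).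
  { intros s. unfold kernel_int, F. rewrite int_scal; [easy|].
    apply dom_bdd_cont_mult; [easy|now apply kernel_dom]. }
  assert (E2 : forall t, int (fun s => F s t) = f t * int (fun s => Derive_n phi 2 s * k s t)).
  { intros t. rewrite <- int_scal.
    - apply int_ext. intros s. unfold F. ring.
    - apply dom_schwartz_mult; [easy| |].
      + intros s. now apply (cont2_l k).
      + now apply pgrow_dv. }
  split.
  - rewrite (int_ext _ _ E1). rewrite (int_int_swap (B * M) F CF DF). now apply int_ext.
  - apply (dom_ext _ _ E2).
    apply (dom_int_param (B * M) (fun t s => F s t)); [now apply cont2_swap|now apply dominated2_swap].
Qed.

(** The real part of the integral of -F(t) (d/dt) v_s(t); [Omega_im] is the imaginary part.
    Separating components reduces everything to real kernel integrals. *)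
Definition Omega_re (F : R -> C) (s : R) : R :=
  kernel_int dv_im (fun t => snd (F t)) s - kernel_int dv_re (fun t => fst (F t)) s.

Definition Omega_im (F : R -> C) (s : R) : R :=
  - kernel_int dv_im (fun t => fst (F t)) s - kernel_int dv_re (fun t => snd (F t)) s.

Lemma cdom_stieltjes s F : Bc F -> cdom (fun t => Cmult (F t) (DeriveC (v s) t)).
Proof.
  intros HF. pose proof (Bc_re F HF) as H1. pose proof (Bc_im F HF) as H2.
  pose proof (kernel_dom _ s kernel_bound_re) as K1. pose proof (kernel_dom _ s kernel_bound_im) as K2.
  split.
  - apply dom_ext with (fun t => fst (F t) * dv_re s t - snd (F t) * dv_im s t).
    + intros t. rewrite DeriveC_v. reflexivity.
    + apply dom_minus; now apply dom_bdd_cont_mult.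
  - apply dom_ext with (fun t => fst (F t) * dv_im s t + snd (F t) * dv_re s t).
    + intros t. rewrite DeriveC_v. reflexivity.
    + apply dom_plus; now apply dom_bdd_cont_mult.
Qed.

Lemma Omega_stieltjes f s : Omega f s = Copp (stieltjes (prim f) (v s)).
Proof. unfold Omega, pairing. rewrite lim_pinfty_v. ring. Qed.

Lemma Omega_components f : Ac f -> Omega f = fun s => (Omega_re (prim f) s, Omega_im (prim f) s).
Proof.
  intros Hf. destruct (prim_spec f Hf) as [HF _]. apply functional_extensionality. intros s.
  rewrite Omega_stieltjes. unfold stieltjes. rewrite Rint_components by now apply cdom_stieltjes.
  pose proof (Bc_re _ HF) as H1. pose proof (Bc_im _ HF) as H2.
  pose proof (kernel_dom _ s kernel_bound_re) as K1. pose proof (kernel_dom _ s kernel_bound_im) as K2.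
  unfold Copp, Omega_re, Omega_im, kernel_int; cbn [fst snd]. f_equal.
  - rewrite <- int_minus by now apply dom_bdd_cont_mult.
    rewrite (int_ext _ (fun t => (-1) * (snd (prim f t) * dv_im s t - fst (prim f t) * dv_re s t))).
    + rewrite int_scal; [ring|]. apply dom_minus; now apply dom_bdd_cont_mult.
    + intros t. rewrite DeriveC_v. simpl. ring.
  - rewrite (int_ext _ (fun t => fst (prim f t) * dv_im s t + snd (prim f t) * dv_re s t)).
    + rewrite int_plus by now apply dom_bdd_cont_mult. ring.
    + intros t. rewrite DeriveC_v. simpl. ring.
Qed.

Lemma linear_Omega : linear_on Ac Omega.
Proof.
  destruct iso_prim as [PB [_ [_ [PA [PS _]]]]].
  split.
  - intros u w Hu Hw. apply functional_extensionality. intros s. unfold addf at 2.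
    rewrite !Omega_stieltjes, PA by easy.
    transitivity (Copp (Cplus (stieltjes (prim u) (v s)) (stieltjes (prim w) (v s)))); [|ring].
    unfold stieltjes. rewrite <- Rint_plus by (apply cdom_stieltjes; auto).
    do 2 f_equal. apply functional_extensionality. intros t. unfold addf. ring.
  - intros c u Hu. apply functional_extensionality. intros s. unfold scalf at 2.
    rewrite !Omega_stieltjes, PS by easy.
    transitivity (Copp (Cmult c (stieltjes (prim u) (v s)))); [|ring].
    unfold stieltjes. rewrite <- Rint_scal by (apply cdom_stieltjes; auto).
    do 2 f_equal. apply functional_extensionality. intros t. unfold scalf. ring.
Qed.

(** * The second distributional derivative of Omega_f and its injectivity *)

Lemma dom_schwartz_kernel_int phi k f : schwartz phi -> kernel_bound k -> bdd_cont f ->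
  dom (fun s => Derive_n phi 2 s * kernel_int k f s).
Proof.
  intros Hp Hk Hf. apply dom_schwartz_mult; [easy| |].
  - intros s. now apply kernel_int_continuous.
  - now apply kernel_int_pgrow.
Qed.

Lemma dom_schwartz_Omega phi F : schwartz phi -> Bc F ->
  dom (fun s => Derive_n phi 2 s * Omega_re F s) /\ dom (fun s => Derive_n phi 2 s * Omega_im F s).
Proof.
  intros Hp HF. pose proof (Bc_re F HF) as H1. pose proof (Bc_im F HF) as H2.
  split.
  - apply dom_ext with (fun s => Derive_n phi 2 s * kernel_int dv_im (fun t => snd (F t)) s -
      Derive_n phi 2 s * kernel_int dv_re (fun t => fst (F t)) s).
    + intros s. unfold Omega_re. ring.
    + apply dom_minus; apply dom_schwartz_kernel_int; auto using kernel_bound_re, kernel_bound_im.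
  - apply dom_ext with (fun s => (-1) * (Derive_n phi 2 s * kernel_int dv_im (fun t => fst (F t)) s) -
      Derive_n phi 2 s * kernel_int dv_re (fun t => snd (F t)) s).
    + intros s. unfold Omega_im. ring.
    + apply dom_minus; [apply dom_scal|]; apply dom_schwartz_kernel_int; auto using kernel_bound_re, kernel_bound_im.
Qed.

Lemma cdom_dderiv2_Omega phi f : schwartz phi -> Ac f ->
  cdom (fun x => Cmult (RtoC (Derive_n phi 2 x)) (Omega f x)).
Proof.
  intros Hp Hf. rewrite (Omega_components f Hf).
  destruct (dom_schwartz_Omega phi (prim f) Hp) as [H1 H2]; [now apply prim_spec|].
  exact (cdom_real_mult (Derive_n phi 2) (fun s => (Omega_re (prim f) s, Omega_im (prim f) s)) H1 H2).
Qed.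

Lemma linear_dderiv2_Omega : linear_on Ac (fun f => dderiv2 (Omega f)).
Proof.
  destruct linear_Omega as [OA OS].
  split.
  - intros u w Hu Hw. rewrite OA by easy. apply on_schwartz_add. intros phi Hp.
    rewrite <- Rint_plus by now apply cdom_dderiv2_Omega.
    f_equal. apply functional_extensionality. intros x. unfold addf. ring.
  - intros c u Hu. rewrite OS by easy. apply on_schwartz_scal. intros phi Hp.
    rewrite <- Rint_scal by now apply cdom_dderiv2_Omega.
    f_equal. apply functional_extensionality. intros x. unfold scalf. ring.
Qed.

(* Fubini: the pairing with phi becomes - int F (t) J (t) dt with J (t) = int phi'' (s) d/dt v_s (t) ds. *)
Lemma dderiv2_Omega_zero f phi (Jre Jim : R -> R) :
  Ac f -> dderiv2 (Omega f) = zerof -> schwartz phi ->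
  (forall t, int (fun s => Derive_n phi 2 s * dv_re s t) = Jre t) ->
  (forall t, int (fun s => Derive_n phi 2 s * dv_im s t) = Jim t) ->
  int (fun t => snd (prim f t) * Jim t) = int (fun t => fst (prim f t) * Jre t) /\
  int (fun t => fst (prim f t) * Jim t) = - int (fun t => snd (prim f t) * Jre t).
Proof.
  intros Hf E Hp HJre HJim. apply functional_extensionality in HJre, HJim. subst Jre Jim.
  destruct (prim_spec f Hf) as [HF _].
  pose proof (Bc_re _ HF) as H1. pose proof (Bc_im _ HF) as H2.
  destruct (dom_schwartz_Omega phi _ Hp HF) as [D1 D2].
  apply (f_equal (fun d => d phi)) in E. unfold dderiv2, zerof in E.
  rewrite on_schwartz_eq, (Omega_components f Hf), Rint_real_mult in E by easy.
  assert (E1 : int (fun s => Derive_n phi 2 s * Omega_re (prim f) s) = 0) by exact (f_equal fst E).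
  assert (E2 : int (fun s => Derive_n phi 2 s * Omega_im (prim f) s) = 0) by exact (f_equal snd E).
  pose proof (fun k g Hk Hg => proj1 (int_schwartz_kernel phi k g Hp Hk Hg)) as S.
  rewrite (int_ext _ (fun s => Derive_n phi 2 s * kernel_int dv_im (fun t => snd (prim f t)) s -
    Derive_n phi 2 s * kernel_int dv_re (fun t => fst (prim f t)) s)) in E1
    by (intros s; unfold Omega_re; ring).
  rewrite (int_ext _ (fun s => (-1) * (Derive_n phi 2 s * kernel_int dv_im (fun t => fst (prim f t)) s) -
      Derive_n phi 2 s * kernel_int dv_re (fun t => snd (prim f t)) s)) in E2
    by (intros s; unfold Omega_im; ring).
  rewrite int_minus, !S in E1
    by (try apply dom_schwartz_kernel_int; auto using kernel_bound_re, kernel_bound_im).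
  rewrite int_minus, int_scal, !S in E2
    by (try apply dom_scal; try apply dom_schwartz_kernel_int; auto using kernel_bound_re, kernel_bound_im).
  split; lra.
Qed.

(** After integration by parts phi meets -s sin(st) and -s cos(st). The product formula for sin(st)
    cos(xs) gives two sine transforms, at t+x and t-x. The other integrand is odd, since this phi is
    even. *)
Lemma int_gauss_cos_J l x t : 0 < l ->
  let phi s := exp (- l * s ^ 2) * cos (x * s) in
  int (fun s => Derive_n phi 2 s * dv_re s t) =
    - / 2 * (int (gauss_sin l (t + x)) + int (gauss_sin l (t - x))) /\
  int (fun s => Derive_n phi 2 s * dv_im s t) = 0.
Proof.
  intros Hl phi.
  assert (Hp : schwartz phi) by (apply (gauss_poly_schwartz l 0 x); [easy|apply gauss_poly_cos]).
  assert (Ds : forall y, dom (gauss_sin l y))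
    by (intros y; apply (gauss_poly_dom l 0 y); [easy|apply gauss_poly_gauss_sin]).
  rewrite (int_schwartz_dv_re phi t Hp), (int_schwartz_dv_im phi t Hp). split.
  - rewrite <- int_plus, <- int_scal by (try apply dom_plus; easy).
    apply int_ext. intros s. unfold phi, gauss_sin.
    replace ((t + x) * s) with (s * t + x * s) by ring.
    replace ((t - x) * s) with (s * t - x * s) by ring.
    rewrite sin_plus, sin_minus. field.
  - apply int_odd.
    + apply (dom_schwartz_mult phi 0); [easy| |].
      * intros s. apply (ex_derive_continuous (fun s => - (s * cos (s * t)))). auto_derive. auto.
      * destruct (pgrow_mult _ _ (pgrow_const (-1)) (pgrow_mult _ _ pgrow_id (pgrow_cos_lin t))) as [k [K H]].
        exists k, K. intros s. specialize (H s). now replace (- (s * cos (s * t))) with (-1 * (s * cos (s * t))) by ring.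
    + intros s. unfold phi. replace (x * - s) with (- (x * s)) by ring.
      replace (- s * t) with (- (s * t)) by ring. rewrite !cos_neg.
      replace ((- s) ^ 2) with (s ^ 2) by ring. ring.
Qed.

(** The odd companion of the cosine case: the parities are exchanged, so J is now purely imaginary,
    and the product formula for cos(st) sin(xs) gives a difference where the cosine gave a sum. *)
Lemma int_gauss_sin_J l x t : 0 < l ->
  let phi s := exp (- l * s ^ 2) * sin (x * s) in
  int (fun s => Derive_n phi 2 s * dv_im s t) =
    - / 2 * (int (gauss_sin l (t + x)) - int (gauss_sin l (t - x))) /\
  int (fun s => Derive_n phi 2 s * dv_re s t) = 0.
Proof.
  intros Hl phi.
  assert (Hp : schwartz phi) by (apply (gauss_poly_schwartz l 0 x); [easy|apply gauss_poly_sin]).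
  assert (Ds : forall y, dom (gauss_sin l y))
    by (intros y; apply (gauss_poly_dom l 0 y); [easy|apply gauss_poly_gauss_sin]).
  rewrite (int_schwartz_dv_re phi t Hp), (int_schwartz_dv_im phi t Hp). split.
  - rewrite <- int_minus, <- int_scal by (try apply dom_minus; easy).
    apply int_ext. intros s. unfold phi, gauss_sin.
    replace ((t + x) * s) with (s * t + x * s) by ring.
    replace ((t - x) * s) with (s * t - x * s) by ring.
    rewrite sin_plus, sin_minus. field.
  - apply int_odd.
    + apply (dom_schwartz_mult phi 0); [easy| |].
      * intros s. apply (ex_derive_continuous (fun s => - (s * sin (s * t)))). auto_derive. auto.
      * destruct (pgrow_mult _ _ (pgrow_const (-1)) (pgrow_mult _ _ pgrow_id (pgrow_sin_lin t))) as [k [K H]].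
        exists k, K. intros s. specialize (H s). now replace (- (s * sin (s * t))) with (-1 * (s * sin (s * t))) by ring.
    + intros s. unfold phi. replace (x * - s) with (- (x * s)) by ring.
      replace (- s * t) with (- (s * t)) by ring. rewrite !sin_neg.
      replace ((- s) ^ 2) with (s ^ 2) by ring. ring.
Qed.

(** The width 1/(4m) is dual to m: its sine transform is c times [(t - x) * gauss m x t] at t - x,
    and the same with centre -x at t + x. If [A] and [A'] are the integrals against these, the
    hypotheses say A' + A = 0 and A' - A = 0, hence A = 0. *)
Lemma gauss_orthogonal_of_sum_diff g m x : bdd_cont g -> 0 < m ->
  let h y := int (gauss_sin (/ (4 * m)) y) in
  int (fun t => g t * (- / 2 * (h (t + x) + h (t - x)))) = 0 ->
  int (fun t => g t * (- / 2 * (h (t + x) - h (t - x)))) = 0 ->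
  int (fun t => g t * ((t - x) * gauss m x t)) = 0.
Proof.
  intros Hg Hm h E1 E2.
  assert (Hl : 0 < / (4 * m)) by (apply Rinv_0_lt_compat; lra).
  destruct (int_gauss_sin _ Hl) as [c [Hc Hh]].
  assert (Eh : forall x t, h (t - x) = c * ((t - x) * gauss m x t)).
  { intros y t. unfold h. rewrite Hh. unfold gauss.
    replace (/ (4 * / (4 * m))) with m by (field; lra). reflexivity. }
  assert (D : forall y, dom (fun t => (t - y) * gauss m y t))
    by (intros y; apply (gauss_poly_dom m (2 * m * y) 0); [easy|apply gauss_poly_central1]).
  set (A := int (fun t => g t * ((t - x) * gauss m x t))).
  set (A' := int (fun t => g t * ((t - - x) * gauss m (- x) t))).
  rewrite (int_ext _ (fun t => (- / 2 * c) * (g t * ((t - - x) * gauss m (- x) t)) +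
    (- / 2 * c) * (g t * ((t - x) * gauss m x t)))) in E1.
  - rewrite (int_ext _ (fun t => (- / 2 * c) * (g t * ((t - - x) * gauss m (- x) t)) -
      (- / 2 * c) * (g t * ((t - x) * gauss m x t)))) in E2.
    + rewrite int_plus, !int_scal in E1 by (try apply dom_scal; now apply dom_bdd_cont_mult).
      rewrite int_minus, !int_scal in E2 by (try apply dom_scal; now apply dom_bdd_cont_mult).
      fold A A' in E1, E2. assert (c * A = 0) as Z by lra.
      apply Rmult_integral in Z. destruct Z; [lra|easy].
    + intros t. replace (t + x) with (t - - x) by ring. rewrite !Eh. ring.
  - intros t. replace (t + x) with (t - - x) by ring. rewrite !Eh. ring.
Qed.

Lemma dderiv2_Omega_kernel f : Ac f -> dderiv2 (Omega f) = zerof -> f = zerof.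
Proof.
  intros Hf E. destruct (prim_spec f Hf) as [HF Ef].
  assert (Z : prim f = zerof).
  { assert (K : forall m x, 0 < m ->
      int (fun t => fst (prim f t) * ((t - x) * gauss m x t)) = 0 /\
      int (fun t => snd (prim f t) * ((t - x) * gauss m x t)) = 0).
    { intros m x Hm.
      assert (Hl : 0 < / (4 * m)) by (apply Rinv_0_lt_compat; lra).
      set (l := / (4 * m)) in *.
      assert (Zero : forall g : R -> R, int (fun t => g t * 0) = 0).
      { intros g. rewrite (int_ext _ (fun _ => 0 * 0)) by (intros; ring).
        rewrite int_scal; [ring|]. split; [intros; apply continuous_const|].
        exists 0. intros t. rewrite Rabs_R0. unfold Rdiv. lra. }
      (* With one component of J equal to zero, the coupled equations split into one for
         [fst (prim f t)] and one for [snd (prim f t)]. The cosine supplies the sum relation and the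
         sine the difference relation for each. *)
      destruct (dderiv2_Omega_zero f _ _ _ Hf E (gauss_poly_schwartz l 0 x _ Hl (gauss_poly_cos l x))
        (fun t => proj1 (int_gauss_cos_J l x t Hl)) (fun t => proj2 (int_gauss_cos_J l x t Hl))) as [P1 P2].
      destruct (dderiv2_Omega_zero f _ _ _ Hf E (gauss_poly_schwartz l 0 x _ Hl (gauss_poly_sin l x))
        (fun t => proj2 (int_gauss_sin_J l x t Hl)) (fun t => proj1 (int_gauss_sin_J l x t Hl))) as [Q1 Q2].
      rewrite Zero in P1, P2, Q1, Q2.
      split.
      - apply gauss_orthogonal_of_sum_diff; [now apply Bc_re|easy|fold l; lra|fold l; lra].
      - apply gauss_orthogonal_of_sum_diff; [now apply Bc_im|easy|fold l; lra|fold l; lra]. }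
    exact (Bc_zero _ HF (fun m x Hm => proj1 (K m x Hm)) (fun m x Hm => proj2 (K m x Hm))). }
  rewrite Ef, Z. destruct linear_dderiv as [_ DS].
  replace (@zerof R) with (scalf (RtoC 0) (@zerof R)).
  - rewrite DS by exact (proj1 subspace_Bc). apply functional_extensionality. intros phi. unfold scalf, zerof. ring.
  - apply functional_extensionality. intros t. unfold scalf, zerof. ring.
Qed.

Lemma dderiv2_Omega_injective f g : Ac f -> Ac g ->
  dderiv2 (Omega f) = dderiv2 (Omega g) -> f = g.
Proof.
  apply (linear_on_injective Ac (fun f => dderiv2 (Omega f))).
  - apply banach_Ac.
  - apply linear_dderiv2_Omega.
  - apply dderiv2_Omega_kernel.
Qed.

(** * The isometries onto C_c and D_c *)

Lemma iso_Omega : isometric_iso_via Omega Ac alex Cc norm1.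
Proof.
  apply (iso_via_image Ac alex Omega linear_Omega).
  (* Equal transforms have equal second derivatives, so injectivity of f |-> Omega_f is inherited
     from the stronger statement for Omega_f''. *)
  intros f g Hf Hg E. apply dderiv2_Omega_injective; [easy|easy|]. now rewrite E.
Qed.

Lemma iso_dderiv2_Omega : isometric_iso_via (fun f => dderiv2 (Omega f)) Ac alex Dc norm2.
Proof.
  apply (iso_via_image Ac alex (fun f => dderiv2 (Omega f)) linear_dderiv2_Omega).
  exact dderiv2_Omega_injective.
Qed.

Theorem mainTheorem2 :
  (* (a) *)
  (banach Cc norm1 /\ isometric_iso_via Omega Ac alex Cc norm1) /\
  (* (b) *)
  (banach Dc norm2 /\ isometric_iso_via (fun f => dderiv2 (Omega f)) Ac alex Dc norm2) /\
  (* (c) *)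
  (banach Ac alex /\ banach Bc supnorm /\ banach Cc norm1 /\ banach Dc norm2 /\
   isometric_iso_via prim Ac alex Bc supnorm /\
   isometric_iso Ac alex Cc norm1 /\ isometric_iso Ac alex Dc norm2 /\
   isometric_iso Bc supnorm Cc norm1 /\ isometric_iso Bc supnorm Dc norm2 /\
   isometric_iso Cc norm1 Dc norm2).
Proof.
  pose proof banach_Ac as BA. pose proof banach_Bc as BB.
  pose proof (banach_transfer _ _ _ _ _ BA iso_Omega) as BC.
  pose proof (banach_transfer _ _ _ _ _ BA iso_dderiv2_Omega) as BD.
  assert (AC : isometric_iso Ac alex Cc norm1) by (eexists; apply iso_Omega).
  assert (AD : isometric_iso Ac alex Dc norm2) by (eexists; apply iso_dderiv2_Omega).
  assert (BtoA : isometric_iso Bc supnorm Ac alex) by (eexists; apply iso_dderiv).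
  repeat match goal with |- _ /\ _ => split end; try assumption.
  - apply iso_Omega.
  - apply iso_dderiv2_Omega.
  - apply iso_prim.
  - now apply isometric_iso_trans with Ac alex.
  - now apply isometric_iso_trans with Ac alex.
  - apply isometric_iso_trans with Ac alex; [|easy].
    apply isometric_iso_sym; [apply BA|easy].
Qed.
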